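(* Suppose $1\le p<\infty$, and let $Y$ be a non-superreflexive Banach space. Then, for every $\varepsilon>0$ and $k\in\mathbb{N}$, $D_k^\omega$ admits a bi-Lipschitz embedding into $L_p([0,1],Y)$ with distortion at most $2^{1+1/p}+\varepsilon$.
   Context: Countably branching diamond graphs: $D_0^\omega$ is the graph with two vertices joined by an edge. For $k\ge 0$, $D_{k+1}^\omega$ is obtained from $D_k^\omega$ by removing each edge $\{u,v\}$ and adding instead a countably infinite set of new vertices (disjoint sets for distinct edges), each joined by an edge to $u$ and to $v$ and to nothing else. The metric space $D_k^\omega$ is its vertex set with the shortest path metric, edges having length one. A bi-Lipschitz embedding $f\colon X\to Z$ has distortion at most $D$ if there is $s>0$ with $s\,d_X(x,y)\le d_Z(f(x),f(y))\le D s\,d_X(x,y)$ for all $x,y\in X$. $L_p([0,1],Y)$ is the Bochner space. *)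

(* Defs.v *)
From HB Require Import structures.
From mathcomp Require Import all_boot all_order all_algebra.
From mathcomp Require Import all_classical all_reals all_analysis.

Set Implicit Arguments.
Unset Strict Implicit.
Unset Printing Implicit Defensive.

Import Order.TTheory GRing.Theory Num.Theory.
Import numFieldNormedType.Exports.

Local Open Scope classical_set_scope.
Local Open Scope ring_scope.

Section Dual.
Context {R : realType} (X : normedModType R).

Definition is_dual (f : X -> R^o) : bool :=
  `[< linear f /\ exists M : R, forall x, `|f x| <= M * `|x| >].

Record dual := MkDual { dual_fun :> X -> R^o ; dualP : is_dual dual_fun }.

HB.instance Definition _ := [isSub for dual_fun].
HB.instance Definition _ := [Choice of dual by <:].

Fact is_dual_submod_closed : submod_closed is_dual.
Proof.
split.
  apply/asboolP; split; first by move=> a x y; rewrite [RHS]addr0 scaler0.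
  by exists 0 => x; rewrite normr0 mul0r.
move=> a f g /asboolP[lf [M Mf]] /asboolP[lg [N Ng]]; apply/asboolP.
have E x : (a *: f + g) x = a * f x + g x by [].
split.
  move=> b x y; rewrite !E lf lg.
  rewrite [LHS](_ : _ = a * (b * f x + f y) + (b * g x + g y))//.
  rewrite [RHS](_ : _ = b * (a * f x + g x) + (a * f y + g y))//.
  by rewrite !mulrDr !mulrA (mulrC b a) addrACA.
exists (`|a| * M + N) => x; rewrite E mulrDl.
apply: (le_trans (ler_normD _ _)); rewrite lerD//.
by rewrite normrM -mulrA ler_wpM2l.
Qed.

HB.instance Definition _ :=
  GRing.isSubmodClosed.Build R (X -> R^o) is_dual is_dual_submod_closed.
HB.instance Definition _ := [SubChoice_isSubLmodule of dual by <:].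

Definition dual_norm (f : dual) : R := sup [set `|f x| | x in [set x | `|x| <= 1]].

Let dual_linear (f : dual) : linear f.
Proof. by have /asboolP[] := dualP f. Qed.

Let dual0 (f : dual) : f 0 = 0.
Proof. by have := dual_linear f (- 1) 0 0; rewrite scaler0 addr0 scaleN1r addNr. Qed.

Let dualZ (f : dual) a x : f (a *: x) = a * f x.
Proof. by have := dual_linear f a x 0; rewrite !addr0 dual0 addr0. Qed.

Let dual_has_sup (f : dual) : has_sup [set `|f x| | x in [set x | `|x| <= 1]].
Proof.
split; first by exists `|f 0|, 0 => //=; rewrite normr0.
have /asboolP[_ [M Mf]] := dualP f; exists `|M| => _ [x /= x1 <-].
apply: (le_trans (Mf x)); apply: (@le_trans _ _ (`|M| * `|x|)).
  by rewrite ler_wpM2r// ler_norm.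
by rewrite ler_piMr.
Qed.

Lemma dual_norm_le1 (f : dual) x : `|x| <= 1 -> `|f x| <= dual_norm f.
Proof. by move=> x1; apply: (sup_upper_bound (dual_has_sup f)); exists x. Qed.

Lemma dual_norm_leP (f : dual) M :
  (forall x, `|x| <= 1 -> `|f x| <= M) -> dual_norm f <= M.
Proof.
move=> h; apply: ge_sup; first by have [] := dual_has_sup f.
by move=> _ [x /= x1 <-]; exact: h.
Qed.

Let dual_norm_ge0 (f : dual) : 0 <= dual_norm f.
Proof. by apply: le_trans (@dual_norm_le1 f 0 _); rewrite ?normr0. Qed.

Fact dual_ler_normD (f g : dual) : dual_norm (f + g) <= dual_norm f + dual_norm g.
Proof.
apply: dual_norm_leP => x x1; apply: (le_trans (ler_normD _ _)).
by rewrite lerD// dual_norm_le1.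
Qed.

Let dual_normZ_le (a : R) (f : dual) : dual_norm (a *: f) <= `|a| * dual_norm f.
Proof.
apply: dual_norm_leP => x x1; rewrite [X in `|X|](_ : _ = a * f x)//.
by rewrite normrM ler_wpM2l// dual_norm_le1.
Qed.

Fact dual_normrZ (a : R) (f : dual) : dual_norm (a *: f) = `|a| * dual_norm f.
Proof.
apply/eqP; rewrite eq_le dual_normZ_le /=.
have [->|a0] := eqVneq a 0; first by rewrite normr0 mul0r dual_norm_ge0.
rewrite -ler_pdivlMl ?normr_gt0// -normfV.
by rewrite -{1}[f](scalerK a0) dual_normZ_le.
Qed.

Fact dual_norm_eq0 (f : dual) : dual_norm f = 0 -> f = 0.
Proof.
move=> f0; apply/val_inj/funext => x /=.
have [->|x0] := eqVneq x 0; first by rewrite dual0.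
have : `|f (`|x|^-1 *: x)| <= 0.
  rewrite -f0 dual_norm_le1// normrZ normfV normr_id mulVf// normr_eq0//.
rewrite normr_le0 dualZ mulf_eq0 invr_eq0 normr_eq0 (negbTE x0)/=.
by move/eqP.
Qed.

HB.instance Definition _ := Lmodule_isNormed.Build R dual
  dual_ler_normD dual_normrZ dual_norm_eq0.

End Dual.

(* The canonical map X -> X^** is onto. *)
Definition reflexive_space (R : realType) (X : normedModType R) : Prop :=
  forall phi : dual (dual X), exists x : X, forall f : dual X, phi f = f x.

Definition fin_span (R : realType) (X : normedModType R) (n : nat)
    (b : 'I_n -> X) : set X :=
  [set \sum_i a i *: b i | a in [set: 'I_n -> R]].

(* Only the restriction of [T] to the subspace [fin_span b] matters. *)
Definition finitely_representable (R : realType) (X Y : normedModType R) : Prop :=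
  forall (n : nat) (b : 'I_n -> X) (eps : R), 0 < eps ->
  exists T : X -> Y,
    (forall (a : R) (u v : X), fin_span b u -> fin_span b v ->
       T (a *: u + v) = a *: T u + T v) /\
    (forall u : X, fin_span b u -> `|u| <= `|T u| <= (1 + eps) * `|u|).

(* James's definition: X ranges over Banach spaces. *)
Definition superreflexive (R : realType) (Y : normedModType R) : Prop :=
  forall X : completeNormedModType R,
    finitely_representable X Y -> reflexive_space X.

Section Bochner.
Context d (T : measurableType d) (R : realType) (Y : normedModType R).
Variables (mu : {measure set T -> \bar R}) (p : R).

Definition vsimple (s : T -> Y) : Prop :=
  finite_set (range s) /\ forall y, measurable (s @^-1` [set y]).

(* Limits are taken everywhere: a function that is only an a.e. limit of simple
   functions is a.e. equal to one of this kind, so the a.e.-classes below are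
   the usual ones. *)
Definition strongly_measurable (f : T -> Y) : Prop :=
  exists2 s : nat -> T -> Y, (forall n, vsimple (s n)) &
    forall t, s n t @[n --> \oo] --> f t.

Definition vLnorm (f : T -> Y) : \bar R := Lnorm mu p%:E (fun t => `|f t|%:E).

Record bochner_fun := MkBochner {
  bochner_val :> T -> Y ;
  bochner_meas : strongly_measurable bochner_val ;
  bochner_fin : (vLnorm bochner_val < +oo)%E }.

HB.instance Definition _ := gen_eqMixin bochner_fun.
HB.instance Definition _ := gen_choiceMixin bochner_fun.

Definition bochner_eq (f g : bochner_fun) : bool := `[< f = g %[ae mu] >].

Let bochner_eq_refl : reflexive bochner_eq.
Proof. by move=> f; apply/asboolP; exact: ae_eq_refl. Qed.

Let bochner_eq_sym : symmetric bochner_eq.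
Proof. by move=> f g; apply/idP/idP => /asboolP h; apply/asboolP/ae_eq_sym. Qed.

Let bochner_eq_trans : transitive bochner_eq.
Proof.
by move=> f g h /asboolP gf /asboolP fh; apply/asboolP/(ae_eq_trans gf fh).
Qed.

Canonical bochner_eq_canonical :=
  EquivRel bochner_eq bochner_eq_refl bochner_eq_sym bochner_eq_trans.

Definition bochner_space : Type := {eq_quot bochner_eq}%qT.
HB.instance Definition _ := Choice.on bochner_space.
HB.instance Definition _ := EqQuotient.on bochner_space.

(* By Minkowski's inequality the norm below is finite, so [fine] loses nothing;
   it does not depend on the representatives. *)
Definition bochner_dist (u v : bochner_space) : R :=
  fine (vLnorm (fun t => (repr u : bochner_fun) t - (repr v : bochner_fun) t)).

End Bochner.

(* Extension by 0 identifies classes of functions on [0,1] with classes, for this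
   measure, of functions on the line. *)
Definition lebesgue01 (R : realType) :
    {measure set (measurableTypeR R) -> \bar R} :=
  mrestr lebesgue_measure (measurable_itv `[0%R, 1%R]).

Record graph := MkGraph { vert : Type ; adj : vert -> vert -> Prop }.

Definition edge (G : graph) : Type :=
  {e : set (vert G) | exists u v, adj u v /\ e = [set u; v]}.

(* [inr (e, n)] is the n-th new vertex attached to the two ends of [e]. *)
Definition diamond_step (G : graph) : graph :=
  @MkGraph (vert G + edge G * nat)%type (fun x y =>
    match x, y with
    | inl u, inr (e, _) | inr (e, _), inl u => sval e u
    | _, _ => False
    end).

Definition diamond (k : nat) : graph :=
  iter k diamond_step (@MkGraph bool (fun x y => x <> y)).

Definition path_dist (R : realType) (G : graph) (x y : vert G) : R :=
  inf [set (size s)%:R | s in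
    [set s : seq (vert G) | path (fun u v => `[< adj u v >]) x s /\ last x s = y]].

Definition embeds_with_distortion (R : realType) (X Z : Type)
    (dX : X -> X -> R) (dZ : Z -> Z -> R) (D : R) : Prop :=
  exists f : X -> Z, exists2 s : R, 0 < s &
    forall x y, s * dX x y <= dZ (f x) (f y) <= D * s * dX x y.

(* Main.v *)
(* Fix vectors y_i, i < 2^k, of the unit ball of Y such that for every j changing
   the sign of the y_i with i < j in their sum gives a vector of norm almost 2^k.
   Each edge of D_k is sent to one y_i, and each vertex to the sum of the y_i along
   an ascending path to it; when an edge carrying a block of indices is subdivided, a
   coin toss attached to the n-th new vertex decides which half of the block comes
   first on the way through that vertex. The resulting random map is 1-Lipschitz. If
   two vertices lie on branches through different middle vertices n and m of some
   edge, then with probability 1/2 the tosses n and m differ, and on that event a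
   suitable change of signs recovers half of the distance; this gives the distortion
   2 * 2^(1/p).

   The y_i come from James's argument. A functional F in X** outside X is the
   weak-star limit of an ultrafilter on a ball of X; iterated limits along it define a
   spreading norm on finite sequences which dominates the tail sums. Let K_n be the
   least norm of a sequence whose tail sums oscillate n times between values >= 1 and
   <= -1. Since K_n grows at most linearly, K_n / K_(n+1) is close to 1 for some n.
   Staggered copies of a near-optimal sequence for K_(n+1) all have the same norm,
   while their averages with the prescribed signs still oscillate n times. *)
Require Import Defs.
From mathcomp Require Import all_boot all_order all_algebra.
From mathcomp Require Import all_classical all_reals all_analysis.
From mathcomp Require Import measurable_realfun.
From mathcomp Require Import ring lra zify.

Import Order.TTheory GRing.Theory Num.Theory.
Import numFieldNormedType.Exports.

Local Open Scope ring_scope.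
Local Open Scope classical_set_scope.

(** * Hahn-Banach theorem and Goldstine's lemma *)

Section HahnBanach.
Context {R : realType} {V : lmodType R}.
Implicit Types (q : V -> R) (a x y : V) (t : R).

Definition sublinear q :=
  (forall x y, q (x + y) <= q x + q y) /\
  (forall t x, 0 <= t -> q (t *: x) = t * q x).

Lemma sublinear0 q : sublinear q -> q 0 = 0.
Proof. by move=> [_ /(_ 0 0 (lexx _))]; rewrite scale0r mul0r. Qed.

Lemma sublinear_opp q x : sublinear q -> - q (- x) <= q x.
Proof.
move=> sq; rewrite lerNl -subr_ge0 opprK addrC.
by rewrite -(sublinear0 q sq) -(subrr x); case: sq => + _; exact.
Qed.

(* The largest sublinear functional below [q] taking a value at most [- q a]
   at [- a]. *)
Definition tilt q a x := inf [set q (x + t *: a) - t * q a | t in [set t | 0 <= t]].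

Lemma tilt_lb q a x : sublinear q -> lbound
  [set q (x + t *: a) - t * q a | t in [set t | 0 <= t]] (- q (- x)).
Proof.
move=> [sD sZ] _ [t /= t0 <-]; rewrite -sZ//.
have := sD (- x) (x + t *: a); rewrite addKr; lra.
Qed.

Lemma tilt_le q a x t : sublinear q -> 0 <= t ->
  tilt q a x <= q (x + t *: a) - t * q a.
Proof.
move=> sq t0; apply: ge_inf; last by exists t.
by exists (- q (- x)); exact: tilt_lb.
Qed.

Lemma le_tilt q a x c : (forall t, 0 <= t -> c <= q (x + t *: a) - t * q a) ->
  c <= tilt q a x.
Proof.
move=> h; apply: lb_le_inf; last by move=> _ [t t0 <-]; exact: h.
by exists (q (x + 0 *: a) - 0 * q a), 0 => /=.
Qed.

Lemma tilt_le_id q a x : sublinear q -> tilt q a x <= q x.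
Proof.
move=> sq; apply: le_trans (tilt_le q a x 0 sq (lexx _)) _.
by rewrite scale0r addr0 mul0r subr0.
Qed.

Lemma tilt_opp q a : sublinear q -> tilt q a (- a) <= - q a.
Proof.
move=> sq; apply: le_trans (tilt_le q a (- a) 1 sq ler01) _.
by rewrite scale1r addNr mul1r sublinear0// sub0r.
Qed.

Lemma tilt_sublinear q a : sublinear q -> sublinear (tilt q a).
Proof.
move=> sq; have [sD sZ] := sq; split=> [x y|t x].
  rewrite -lerBlDr; apply: le_tilt => s s0.
  rewrite lerBlDr [leRHS]addrC -lerBlDr; apply: le_tilt => u u0.
  have su0 : 0 <= u + s by exact: addr_ge0.
  have := tilt_le q a (x + y) (u + s) sq su0.
  have := sD (x + s *: a) (y + u *: a).
  have -> : x + s *: a + (y + u *: a) = x + y + (u + s) *: a.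
    by rewrite scalerDl addrACA (addrC (u *: a)).
  rewrite mulrDl; lra.
rewrite le_eqVlt => /predU1P[<-|t0].
  rewrite scale0r mul0r; apply/eqP; rewrite eq_le; apply/andP; split.
    by rewrite -(sublinear0 q sq) tilt_le_id.
  by apply: le_tilt => s s0; rewrite add0r sZ// subrr.
apply/eqP; rewrite eq_le; apply/andP; split.
  rewrite -ler_pdivrMl//; apply: le_tilt => s s0; rewrite ler_pdivrMl//.
  have ts0 : 0 <= t * s by rewrite mulr_ge0// ltW.
  apply: le_trans (tilt_le q a _ _ sq ts0) _.
  by rewrite -scalerA -scalerDr (sZ _ _ (ltW t0)) mulrBr mulrA.
apply: le_tilt => s s0; rewrite -ler_pdivlMl//.
have ts0 : 0 <= t^-1 * s by rewrite mulr_ge0// ltW// invr_gt0.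
apply: le_trans (tilt_le q a _ _ sq ts0) _.
rewrite mulrBr mulrA lerD2r -sZ; last by rewrite invr_ge0 ltW.
by rewrite scalerDr !scalerA mulVf ?gt_eqF// scale1r.
Qed.

(** Zorn's lemma for the reversed pointwise order. A nonempty chain is bounded by its pointwise
    infimum, which is finite because every sublinear [h] below [q] satisfies [h x >= - q (- x)]. *)
Lemma sublinear_minimal q : sublinear q -> exists2 g, sublinear g &
  (forall x, g x <= q x) /\
  forall h, sublinear h -> (forall x, h x <= g x) -> h = g.
Proof.
move=> sq; pose T := {g | sublinear g /\ forall x, g x <= q x}.
pose r (f g : T) := `[< forall x, sval g x <= sval f x >].
have [| | | |[g [sg gq]] gmax] := @Zorn T r.
- by move=> f; apply/asboolP.
- move=> f g h /asboolP fg /asboolP gh; apply/asboolP => x.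
  exact: le_trans (gh x) (fg x).
- move=> [f pf] [g pg] /asboolP fg /asboolP gf; apply: eq_exist.
  by apply/funext => x; apply/eqP; rewrite eq_le fg gf.
- move=> A totA; have [[f0 Af0]|A0] := pselect (exists f, A f); last first.
    exists (exist (fun g => sublinear g /\ forall x, g x <= q x) q
      (conj sq (fun x => lexx (q x)))).
    by move=> f Af; exfalso; apply: A0; exists f.
  pose g x := inf [set sval f x | f in A].
  have gle f x : A f -> g x <= sval f x.
    move=> Af; apply: ge_inf; last by exists f.
    exists (- q (- x)) => _ [[h [sh hq]] _ <-] /=.
    by apply: le_trans (sublinear_opp h x sh); rewrite lerN2.
  have leg x c : (forall f, A f -> c <= sval f x) -> c <= g x.
    move=> h; apply: lb_le_inf; first by exists (sval f0 x), f0.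
    by move=> _ [f Af <-]; exact: h.
  have sg : sublinear g.
    split=> [x y|t x].
      suff fh f h : A f -> A h -> g (x + y) <= sval f x + sval h y.
        rewrite -lerBlDr; apply: (leg _ _) => f Af.
        suff : g (x + y) - sval f x <= g y by lra.
        by apply: (leg _ _) => h Ah; rewrite lerBlDl; exact: fh.
      move=> Af Ah.
      have [/asboolP fh|/asboolP hf] := totA _ _ Af Ah.
        apply: le_trans (gle _ _ Ah) _; case: (svalP h) => -[hD _] _.
        by apply: le_trans (hD _ _) _; rewrite lerD2r.
      apply: le_trans (gle _ _ Af) _; case: (svalP f) => -[hD _] _.
      by apply: le_trans (hD _ _) _; rewrite lerD2l.
    rewrite le_eqVlt => /predU1P[<-|t0].
      rewrite scale0r mul0r; apply/eqP; rewrite eq_le; apply/andP; split.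
        apply: le_trans (gle _ _ Af0) _; case: (svalP f0) => sf _.
        by rewrite sublinear0.
      by apply: (leg _ _) => f _; case: (svalP f) => sf _; rewrite sublinear0.
    apply/eqP; rewrite eq_le; apply/andP; split.
      rewrite -ler_pdivrMl//; apply: (leg _ _) => f Af; rewrite ler_pdivrMl//.
      by case: (svalP f) => -[_ fZ] _; rewrite -(fZ _ _ (ltW t0)); exact: gle.
    apply: (leg _ _) => f Af; case: (svalP f) => -[_ fZ] _; rewrite (fZ _ _ (ltW t0)).
    by rewrite ler_pM2l//; exact: gle.
  have gq x : g x <= q x.
    by apply: le_trans (gle _ _ Af0) _; case: (svalP f0).
  by exists (exist _ g (conj sg gq)) => f Af; apply/asboolP => x; exact: gle.
exists g => //; split=> // h sh hg.
have hq x : h x <= q x by exact: le_trans (hg x) (gq x).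
have /(_ (exist _ h (conj sh hq))) := gmax.
have rh : r (exist _ g (conj sg gq)) (exist _ h (conj sh hq)).
  by apply/asboolP.
by move=> /(_ rh) [].
Qed.

(** Take a minimal [f] below [tilt q a]. Minimality gives [tilt f x = f] for every [x], so
    [tilt_opp] makes [f] odd, and an odd sublinear functional is linear. The tilt at [a] forces the
    value [q a]. *)
Theorem hahn_banach q a : sublinear q -> exists f : V -> R,
  [/\ linear (f : V -> R^o), (forall x, f x <= q x) & f a = q a].
Proof.
move=> sq; have [f sf [fle fmin]] := sublinear_minimal _ (tilt_sublinear q a sq).
have fN x : f (- x) = - f x.
  apply/eqP; rewrite eq_le; apply/andP; split; last first.
    by rewrite -[leRHS]opprK lerN2; have := sublinear_opp f x sf; lra.
  have {1}<- := fmin _ (tilt_sublinear f x sf) (fun y => tilt_le_id f x y sf).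
  exact: tilt_opp.
have [fD fZ] := sf.
exists f; split.
- move=> t x y; have -> : f (t *: x + y) = f (t *: x) + f y.
    apply/eqP; rewrite eq_le fD/=.
    have := fD (t *: x + y) (- y); rewrite addrK fN; lra.
  have [t0|t0] := leP 0 t; first by rewrite fZ.
  by rewrite -[t]opprK scaleNr fN fZ ?oppr_ge0 ?ltW// scaleNr.
- by move=> x; apply: le_trans (fle x) (tilt_le_id q a x sq).
- apply/eqP; rewrite eq_le (le_trans (fle a) (tilt_le_id q a a sq))/=.
  rewrite -lerN2 -fN; exact: le_trans (fle _) (tilt_opp q a sq).
Qed.

End HahnBanach.

(** * Continuous functionals on a normed space *)

Section DualTheory.
Context {R : realType} {X : normedModType R}.
Implicit Types (f g : dual X) (x y : X).

Lemma dual_linear f : linear f.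
Proof. by have /asboolP[] := dualP f. Qed.

Lemma dual0 f : f 0 = 0.
Proof.
have := dual_linear f (- 1) 0 0.
by rewrite scaler0 addr0 scaleN1r addNr.
Qed.

Lemma dualZ f (a : R) x : f (a *: x) = a * f x.
Proof. by have := dual_linear f a x 0; rewrite !addr0 dual0 addr0. Qed.

Lemma dualD f x y : f (x + y) = f x + f y.
Proof. by have := dual_linear f 1 x y; rewrite !scale1r. Qed.

Lemma dual_addE f g x : (f + g) x = f x + g x. Proof. by []. Qed.

Lemma dual_scaleE (a : R) f x : (a *: f) x = a * f x. Proof. by []. Qed.

Lemma dual_bound f x : `|f x| <= `|f| * `|x|.
Proof.
have [->|x0] := eqVneq x 0; first by rewrite dual0 !normr0 mulr0.
have nx0 : 0 < `|x| by rewrite normr_gt0.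
have := @dual_norm_le1 _ _ f (`|x|^-1 *: x).
rewrite normrZ normfV normr_id mulVf ?gt_eqF// => /(_ (lexx _)).
by rewrite dualZ normrM normfV normr_id ler_pdivrMl// mulrC.
Qed.

Lemma norm_sublinear : sublinear (fun x : X => `|x|).
Proof.
by split=> [x y|t x t0]; [exact: ler_normD|rewrite normrZ ger0_norm].
Qed.

Lemma dual_of_le_norm (f : X -> R) : linear (f : X -> R^o) ->
  (forall x, f x <= `|x|) -> exists2 g : dual X, `|g| <= 1 & forall x, g x = f x.
Proof.
move=> lf fle.
have fN x : f (- x) = - f x.
  have f0 : f 0 = 0.
    by have := lf (- 1) 0 0; rewrite scaler0 addr0 scaleN1r addNr.
  by have := lf (- 1) x 0; rewrite !addr0 f0 addr0 !scaleN1r.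
have fb x : `|f x| <= `|x|.
  by rewrite ler_norml fle andbT lerNl -fN (le_trans (fle _))// normrN.
have df : is_dual (f : X -> R^o).
  by apply/asboolP; split=> //; exists 1 => x; rewrite mul1r.
exists (MkDual df) => //.
by apply: dual_norm_leP => x x1; exact: le_trans (fb x) x1.
Qed.

Lemma norming_functional x : exists2 f : dual X, `|f| <= 1 & f x = `|x|.
Proof.
have [f [lf fle fx]] := hahn_banach _ x norm_sublinear.
by have [g g1 gE] := dual_of_le_norm f lf fle; exists g => //; rewrite gE.
Qed.

End DualTheory.

Section Goldstine.
Context {R : realType} {X : normedModType R}.
Variable F : dual (dual X).

(* The gauge [b |-> inf_x |x| + c sum_k |b_k - f_k x|] is dominated by [`|F|] at
   the point [(F f_k)_k]: a linear functional below the gauge is a combination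
   of the [f_k] of norm at most 1. *)
Lemma goldstine n (f : 'I_n -> dual X) (c : R) : 0 < c ->
  forall eta, 0 < eta ->
  exists x, `|x| + c * \sum_k `|F (f k) - f k x| < `|F| + eta.
Proof.
move=> c0 eta eta0.
pose h (b : 'rV[R]_n) x := `|x| + c * \sum_k `|b ord0 k - f k x|.
pose P b := inf [set h b x | x in [set: X]].
have h_ge0 b x : 0 <= h b x.
  by rewrite addr_ge0// (mulr_ge0 (ltW c0))// sumr_ge0.
have Ple b x : P b <= h b x.
  by apply: ge_inf; [exists 0 => _ [z _ <-]|exists x].
have leP b d : (forall x, d <= h b x) -> d <= P b.
  move=> H; apply: lb_le_inf; first by exists (h b 0), 0.
  by move=> _ [x _ <-]; exact: H.
have hZ t b x : 0 <= t -> h (t *: b) (t *: x) = t * h b x.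
  move=> t0; rewrite /h normrZ ger0_norm// mulrDr; congr (_ + _).
  rewrite mulrCA; congr (_ * _); rewrite mulr_sumr; apply: eq_bigr => k _.
  by rewrite mxE dualZ -mulrBr normrM ger0_norm.
have P0 : P 0 = 0.
  apply/eqP; rewrite eq_le; apply/andP; split; last by exact: leP.
  apply: le_trans (Ple 0 0) _; rewrite /h normr0 add0r big1 ?mulr0// => k _.
  by rewrite mxE dual0 subrr normr0.
have sP : sublinear P.
  split=> [a b|t b].
    suff H x y : P (a + b) <= h a x + h b y.
      rewrite -lerBlDr; apply: (leP) => x.
      suff : P (a + b) - h a x <= P b by lra.
      by apply: (leP) => y; rewrite lerBlDl.
    apply: le_trans (Ple _ (x + y)) _; rewrite /h addrACA -mulrDr.
    rewrite lerD ?ler_normD// (ler_wpM2l (ltW c0))// -big_split/=; apply: ler_sum.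
    by move=> k _; rewrite mxE dualD opprD addrACA ler_normD.
  rewrite le_eqVlt => /predU1P[<-|t0]; first by rewrite scale0r mul0r.
  apply/eqP; rewrite eq_le; apply/andP; split.
    rewrite -ler_pdivrMl//; apply: (leP) => x; rewrite ler_pdivrMl//.
    by rewrite -(hZ _ _ _ (ltW t0)).
  apply: (leP) => x; have -> : x = t *: (t^-1 *: x).
    by rewrite scalerA mulfV ?gt_eqF// scale1r.
  by rewrite (hZ _ _ _ (ltW t0)) ler_pM2l.
pose a : 'rV[R]_n := \row_k F (f k).
have [l [ll lle la]] := hahn_banach P a sP.
have l0 : l 0 = 0.
  by have := ll (- 1) 0 0; rewrite scaler0 addr0 scaleN1r addNr.
have lsum (b : 'rV[R]_n) : l b = \sum_k b ord0 k * l (delta_mx ord0 k).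
  rewrite {1}(row_sum_delta b).
  apply: (big_ind2 (fun u v => l u = v)) => //.
    by move=> u1 v1 u2 v2 <- <-; have := ll 1 u1 u2; rewrite !scale1r.
  by move=> k _; have := ll (b ord0 k) (delta_mx ord0 k) 0; rewrite !addr0 l0 addr0.
pose g : dual X := \sum_k l (delta_mx ord0 k) *: f k.
have gE x : g x = l (\row_k f k x).
  rewrite lsum; rewrite /g.
  apply: (big_ind2 (fun (u : dual X) v => u x = v)) => //.
    by move=> u1 v1 u2 v2 <- <-.
  by move=> k _; rewrite mxE mulrC.
have FgE : F g = l a.
  rewrite lsum; rewrite /g.
  apply: (big_ind2 (fun u v => F u = v)); first exact: dual0.
    by move=> u1 v1 u2 v2 <- <-; rewrite dualD.
  by move=> k _; rewrite mxE dualZ mulrC.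
have gle x : g x <= `|x|.
  rewrite gE (le_trans (lle _))// (le_trans (Ple _ x))// /h big1 ?mulr0 ?addr0//.
  by move=> k _; rewrite mxE subrr normr0.
have [g' g'1 g'E] := dual_of_le_norm g (dual_linear g) gle.
have g1 : `|g| <= 1.
  by have <- : g' = g by apply/val_inj/funext => x; exact: g'E.
have : P a < `|F| + eta.
  rewrite -la -FgE (le_lt_trans (ler_norm _))//.
  rewrite (le_lt_trans (dual_bound _ _))//.
  rewrite (@le_lt_trans _ _ `|F|) ?ltrDl//.
  by rewrite -[leRHS]mulr1 ler_wpM2l.
move=> /inf_lt [|_ [x _ <-] hx].
  by exists (h a 0), 0.
exists x; apply: le_lt_trans hx; rewrite /h lerD2l (ler_wpM2l (ltW c0))//.
by apply: ler_sum => k _; rewrite mxE.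
Qed.

End Goldstine.

(** * Elements of the bidual as limits along an ultrafilter *)

Section Nonreflexive.
Context {R : realType} {X : completeNormedModType R}.
Implicit Types (f g : dual X) (x y v : X) (F : dual (dual X)).

(** By [goldstine] the traces on a ball of the basic weak-star neighbourhoods of [F] are nonempty,
    so they form a filter base; any ultrafilter refining it will do. *)
Lemma weak_star_ultrafilter F : exists U : set_system X,
  [/\ UltraFilter U, U [set x | `|x| <= `|F| + 1] & forall f, f @ U --> F f].
Proof.
pose S (fs : seq (dual X)) (eta : R) :=
  [set x | `|x| <= `|F| + 1 /\ forall f, f \in fs -> `|F f - f x| < eta].
pose B := [set A | exists fs, exists2 eta, 0 < eta & S fs eta `<=` A].
have Sn0 fs eta : 0 < eta -> S fs eta !=set0.
  move=> eta0.
  (* With this weight a single error of size [eta] would already cost [|F| + 2], above the bound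
     [|F| + 1] obtained from [goldstine]. *)
  pose c := (`|F| + 1 + 1) / eta.
  have c0 : 0 < c by rewrite divr_gt0// -addrA ltr_wpDl.
  have [x] := @goldstine _ _ F (size fs) (fun k => tnth (in_tuple fs) k) c c0 1 ltr01.
  move=> Hx; exists x; split.
    apply: le_trans (ltW Hx); rewrite lerDl (mulr_ge0 (ltW c0))//.
    by rewrite sumr_ge0.
  move=> f ff; have /tnthP[k ->] : f \in in_tuple fs by [].
  rewrite -(ltr_pM2l c0).
  have -> : c * eta = `|F| + 1 + 1 by rewrite /c divfK ?gt_eqF.
  apply: (@lt_le_trans _ _ (`|F| + 1)); last by rewrite lerDl.
  apply: le_lt_trans Hx; rewrite ler_wpDl// ler_pM2l// (bigD1 k)//= lerDl.
  by rewrite sumr_ge0.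
have FB : ProperFilter B.
  split.
    move=> [fs [eta eta0 /=]].
    by have [x Sx] := Sn0 fs eta eta0; move=> /(_ x Sx).
  split.
  - by exists [::], 1.
  - move=> P Q [fs [e e0 sP]] [gs [d d0 sQ]].
    exists (fs ++ gs), (Num.min e d); first by rewrite lt_min e0.
    move=> x [xF H]; split; [apply: sP|apply: sQ]; split=> // f ff.
      by have := H f; rewrite mem_cat ff lt_min => /(_ isT)/andP[].
    by have := H f; rewrite mem_cat ff orbT lt_min => /(_ isT)/andP[].
  - move=> P Q PQ [fs [e e0 sP]]; exists fs, e => //.
    exact: subset_trans sP PQ.
have [U [UU BU]] := ultraFilterLemma FB.
exists U; split => //.
  by apply: BU; exists [::], 1 => // x [].
move=> f; apply/cvgrPdist_lt => eta eta0; apply: BU.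
by exists [:: f], eta => // x [_ /(_ f)]; rewrite inE eqxx => /(_ isT).
Qed.

(* Otherwise [F] is a limit of evaluations: if [g v = 1] and [|g| |v| = 1] then
   [f - f v *: g] kills [v] and has norm at most [2 |f|], so [F] is within
   [2 theta] of the evaluation at [F g *: v]. *)
Lemma nonreflexive_annihilator F :
  (~ exists x, forall f, F f = f x) ->
  exists2 theta, 0 < theta &
    forall v, exists f : dual X, [/\ `|f| <= 1, f v = 0 & theta <= `|F f|].
Proof.
move=> nF; apply: contrapT => H; apply: nF.
have near_ev theta : 0 < theta -> exists x, forall f, `|F f - f x| <= theta * `|f|.
  move=> t0; pose t2 := theta / 2.
  have t20 : 0 < t2 by rewrite divr_gt0.
  have [v Hv] : exists v, forall f, `|f| <= 1 -> f v = 0 -> `|F f| <= t2.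
    apply: contrapT => H'; apply: H; exists t2 => // v.
    apply: contrapT => H''; apply: H'; exists v => f f1 fv.
    rewrite leNgt; apply/negP => /ltW tF; apply: H''.
    by exists f.
  have Hv' f : f v = 0 -> `|F f| <= t2 * `|f|.
    move=> fv; have [->|f0] := eqVneq f 0; first by rewrite dual0 !normr0 mulr0.
    have nf0 : 0 < `|f| by rewrite normr_gt0.
    have := Hv (`|f|^-1 *: f).
    rewrite normrZ normfV normr_id mulVf ?gt_eqF// dual_scaleE fv mulr0.
    move=> /(_ (lexx _) erefl).
    by rewrite dualZ normrM normfV normr_id ler_pdivrMl// mulrC.
  have [v0|v0] := eqVneq v 0.
    exists 0 => f; rewrite dual0 subr0 (le_trans (Hv' f _)) ?v0 ?dual0//.
    by rewrite ler_wpM2r// /t2; lra.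
  have nv0 : 0 < `|v| by rewrite normr_gt0.
  have [g0 g01 g0v] := norming_functional v.
  pose g := `|v|^-1 *: g0.
  have gv : g v = 1 by rewrite dual_scaleE g0v mulVf ?gt_eqF.
  have gn : `|g| <= `|v|^-1.
    by rewrite normrZ normfV normr_id -[leRHS]mulr1 ler_wpM2l// invr_ge0 ltW.
  exists (F g *: v) => f.
  pose k := (- f v) *: g + f.
  have kv : k v = 0 by rewrite dual_addE dual_scaleE gv mulr1 addNr.
  have -> : F f - f (F g *: v) = F k.
    by rewrite dualD !dualZ; ring.
  rewrite (le_trans (Hv' _ kv))//.
  have fvn : `|f v| * `|g| <= `|f|.
    apply: le_trans (_ : _ <= `|f| * `|v| * `|v|^-1) _.
      by rewrite ler_pM// dual_bound.
    by rewrite mulfK// gt_eqF.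
  have k2 : `|k| <= 2 * `|f|.
    rewrite (le_trans (ler_normD _ _))// normrZ normrN.
    by rewrite mulr_natl mulr2n lerD2r; exact: fvn.
  apply: le_trans (ler_wpM2l (ltW t20) k2) _.
  by rewrite mulrA /t2 divfK.
have /choice[x xP] : forall n, exists x, forall f, `|F f - f x| <= n.+1%:R^-1 * `|f|.
  by move=> n; apply: near_ev; rewrite invr_gt0.
(* Both evaluations are close to [F]; a norming functional of the difference turns this into
   closeness in norm, and completeness then gives a limit representing [F]. *)
have xx n m : `|x n - x m| <= n.+1%:R^-1 + m.+1%:R^-1.
  have [f f1 <-] := norming_functional (x n - x m).
  have fB : f (x n - x m) = f (x n) - f (x m) by rewrite dualD -scaleN1r dualZ mulN1r.
  have le1 i : i.+1%:R^-1 * `|f| <= (i.+1%:R^-1 : R).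
    by rewrite -[leRHS]mulr1 ler_wpM2l// invr_ge0.
  rewrite fB (le_trans (ler_norm _))// (le_trans (ler_distD (F f) _ _))//.
  rewrite lerD//; last exact: le_trans (xP m f) (le1 m).
  by rewrite distrC; exact: le_trans (xP n f) (le1 n).
have inv0 (e : R) : 0 < e -> \forall n \near \oo, n.+1%:R^-1 < e.
  by move=> e0; exact: (near_infty_natSinv_lt (PosNum e0)).
have cx : cvg (x n @[n --> \oo]).
  apply/cauchy_cvgP/cauchy_exP => e e0.
  have e20 : 0 < e / 2 by rewrite divr_gt0.
  have [N _ NP] := inv0 _ e20.
  exists (x N); exists N => // n /NP /= nP.
  rewrite -ball_normE /=; have /= := NP N (leqnn _); have := xx N n.
  by move: nP => /=; move: (n.+1%:R^-1) (N.+1%:R^-1) => a b; lra.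
exists (lim (x n @[n --> \oo])) => f.
set l := lim _.
have xl n : `|x n - l| <= n.+1%:R^-1.
  apply/ler_addgt0Pr => e e0.
  have e20 : 0 < e / 2 by rewrite divr_gt0.
  have [N _ NP] := inv0 _ e20.
  move/cvgrPdist_lt : cx => /(_ _ e20)[N' _ N'P].
  have /= := NP (maxn N N') (leq_maxl _ _).
  have /= := N'P (maxn N N') (leq_maxr _ _).
  set i := maxn N N' => h1 h2.
  have -> : x n - l = (x n - x i) - (l - x i) by rewrite opprB addrA subrK.
  rewrite (le_trans (ler_normB _ _))//; have := xx n i; move: h1 h2.
  by rewrite -/l; move: (n.+1%:R^-1) (i.+1%:R^-1) => a b; lra.
apply/eqP; rewrite -subr_eq0 -normr_le0; apply/ler_addgt0Pr => e e0.
rewrite add0r.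
have f0 : 0 < `|f| + `|f| + 1 by rewrite ltr_wpDl// addr_ge0.
have [N _ NP] := inv0 _ (divr_gt0 e0 f0).
have /= := NP N (leqnn _); rewrite ltr_pdivlMr// => h.
have h1 := xP N f.
have h2 : `|f (x N) - f l| <= N.+1%:R^-1 * `|f|.
  have <- : f (x N - l) = f (x N) - f l by rewrite dualD -scaleN1r dualZ mulN1r.
  by rewrite (le_trans (dual_bound _ _))// mulrC ler_wpM2r// xl.
have -> : F f - f l = (F f - f (x N)) + (f (x N) - f l) by rewrite addrA subrK.
apply: le_trans (ler_normD _ _) _; apply: le_trans (lerD h1 h2) _.
have n0 : 0 <= (N.+1%:R^-1 : R) by rewrite invr_ge0.
by move: h n0; move: (N.+1%:R^-1) => a; rewrite !mulrDr; lra.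
Qed.

End Nonreflexive.

(** * Spreading model of a non-reflexive space *)

(** A closed interval is compact, so the image ultrafilter has a cluster point, and an ultrafilter
    converges to each of its cluster points. *)
Lemma ultra_bounded_cvg {R : realType} {T : Type} (U : set_system T)
    (UU : UltraFilter U) (g : T -> R) (c : R) :
  U [set y | `|g y| <= c] -> cvg (g y @[y --> U]).
Proof.
move=> Uc.
have gU : (g @ U) `[- c, c].
  apply: (@filterS _ U _ [set y | `|g y| <= c]) Uc => y.
  by rewrite /= ler_norml in_itv.
have [p [_ pU]] := @segment_compact R (- c) c (g @ U) _ gU.
apply/cvg_ex; exists p => A Ap.
have [//|UA] := in_ultra_setVsetC (g @^-1` A) UU.
by have [z [nAz Az]] := pU (~` A) A UA Ap.
Qed.

Section IteratedLimit.
Context {R : realType} {X : normedModType R}.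
Variables (U : set_system X) (UU : UltraFilter U).
Variables (M : R) (UM : U [set y | `|y| <= M]).

(* [itlim [:: c_1; ...; c_l] v] is the limit of [|v + c_1 y_1 + ... + c_l y_l|]
   as [y_l], ..., [y_1] tend successively to [U]: the norm of the spreading model
   generated by [U]. *)
Fixpoint itlim (cs : seq R) (v : X) : R :=
  if cs is c :: cs' then lim (itlim cs' (v + c *: y) @[y --> U]) else `|v|.

Lemma ultra_radius_ge0 : 0 <= M.
Proof. by have [y /= yM] := filter_ex UM; exact: le_trans yM. Qed.

(** The two claims support each other: bounds for the shorter list make the next limit exist, and
    that limit inherits bounds. *)
Lemma itlim_spec cs v :
  (0 <= itlim cs v <= `|v| + M * \sum_(c <- cs) `|c|) /\
  forall c, itlim cs (v + c *: y) @[y --> U] --> itlim (c :: cs) v.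
Proof.
have M0 := ultra_radius_ge0.
have step cs' : (forall v, 0 <= itlim cs' v <= `|v| + M * \sum_(c <- cs') `|c|) ->
    forall v c, itlim cs' (v + c *: y) @[y --> U] --> itlim (c :: cs') v.
  move=> H w c; apply: (@ultra_bounded_cvg _ _ _ _ _
    (`|w| + `|c| * M + M * \sum_(c <- cs') `|c|)).
  apply: filterS UM => y /= yM; have /andP[h0 h1] := H (w + c *: y).
  rewrite ger0_norm// (le_trans h1)// lerD2r (le_trans (ler_normD _ _))//.
  by rewrite lerD2l normrZ ler_wpM2l.
have bnd : forall w, 0 <= itlim cs w <= `|w| + M * \sum_(c <- cs) `|c|.
  elim: cs => [|c cs IH] w.
    by rewrite /= big_nil mulr0 addr0 normr_ge0 lexx.
  have C := step cs IH w c.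
  apply/andP; split.
    apply: limr_ge; first exact: cvgP C.
    by near=> y; case/andP: (IH (w + c *: y)).
  apply: limr_le; first exact: cvgP C.
  apply: filterS UM => y /= yM; have /andP[_ h1] := IH (w + c *: y).
  rewrite (le_trans h1)// big_cons mulrDr addrA lerD2r.
  by rewrite (le_trans (ler_normD _ _))// lerD2l normrZ mulrC ler_wpM2r.
by split; [exact: bnd|move=> c; exact: step].
Unshelve. all: by end_near. Qed.

Lemma itlim_le cs v : itlim cs v <= `|v| + M * \sum_(c <- cs) `|c|.
Proof. by have [/andP[]] := itlim_spec cs v. Qed.

Lemma itlim_cvg c cs v : itlim cs (v + c *: y) @[y --> U] --> itlim (c :: cs) v.
Proof. by have [_] := itlim_spec cs v. Qed.

(* Inserting zeros spreads the coefficients without changing the limit. *)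
Lemma itlim_filter cs v : itlim [seq c <- cs | c != 0] v = itlim cs v.
Proof.
elim: cs v => // c cs IH v; have [->|c0] := eqVneq c 0.
  have -> : itlim (0 :: cs) v = itlim cs v.
    apply/cvg_lim => //; under eq_fun do rewrite scale0r addr0.
    exact: cvg_cst.
  by rewrite /= eqxx IH.
by rewrite /= c0 /=; under eq_fun do rewrite IH.
Qed.

(** When [post] begins, [v] carries the vectors already chosen for [pre]. A functional of norm at
    most 1 that kills [v] and tends to [tau] along [U] sees only [tau] times the sum of [post]. The
    functional depends on [v], hence the quantifier in the hypothesis. *)
Lemma itlim_lower (theta : R) : 0 <= theta ->
  (forall v, exists (f : dual X) (tau : R),
     [/\ `|f| <= 1, f v = 0, (f y : R) @[y --> U] --> tau & theta <= `|tau|]) ->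
  forall pre post v, theta * `|\sum_(c <- post) c| <= itlim (pre ++ post) v.
Proof.
move=> theta0 sep; elim=> [|c pre IH] post v /=; last first.
  apply: limr_ge; first by apply: cvgP; exact: itlim_cvg.
  by near=> y; exact: IH.
have [f [tau [f1 fv ftau le_tau]]] := sep v.
suff : `|(f v : R) + tau * \sum_(c <- post) c| <= itlim post v.
  rewrite fv add0r normrM; apply: le_trans; exact: ler_wpM2r.
move: v {fv}; elim: post => [|c cs IH] v.
  rewrite big_nil mulr0 addr0 (le_trans (dual_bound f v))//.
  by rewrite -[leRHS]mul1r ler_wpM2r.
have C1 : `|(f v : R) + c * f y + tau * \sum_(c <- cs) c| @[y --> U] -->
    `|(f v : R) + c * tau + tau * \sum_(c <- cs) c|.
  apply: cvg_norm; apply: cvgD; last exact: cvg_cst.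
  by apply: cvgD; [exact: cvg_cst|apply: cvgM => //; exact: cvg_cst].
rewrite big_cons mulrDr addrA (mulrC tau c).
rewrite -(cvg_lim _ C1)//; apply: ler_lim.
- exact: cvgP C1.
- by apply: cvgP; exact: itlim_cvg.
- near=> y; rewrite -[X in X + _](_ : f (v + c *: y) = _); first exact: IH.
  by rewrite dualD dualZ.
Unshelve. all: by end_near. Qed.

(** All the limits are taken along the same filter, so finitely many of them can be approximated by
    one common choice of vectors. *)
Lemma itlim_approx {T : Type} {I : finType} (W : seq T) (phi : I -> T -> R) :
  forall (v : I -> X) (eta : R), 0 < eta -> exists2 ys : seq X,
    size ys = size W &
    forall k, `|itlim [seq phi k w | w <- W] (v k) -
      `|v k + \sum_(p <- zip W ys) phi k p.1 *: p.2| | < eta.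
Proof.
elim: W => [|w W IH] v eta eta0.
  by exists [::] => // k; rewrite big_nil addr0 subrr normr0.
have eta20 : 0 < eta / 2 by rewrite divr_gt0.
have near_y : \forall y \near U, forall k,
    `|itlim (phi k w :: [seq phi k w | w <- W]) (v k) -
      itlim [seq phi k w | w <- W] (v k + phi k w *: y)| < eta / 2.
  apply: filter_forall => k.
  by move/cvgrPdist_lt : (itlim_cvg (phi k w) [seq phi k w | w <- W] (v k)); exact.
have [y yP] := filter_ex near_y.
have [ys sys ysP] := IH (fun k => v k + phi k w *: y) _ eta20.
exists (y :: ys) => [|k]; first by rewrite /= sys.
rewrite [zip _ _]/= big_cons [(w, y).1]/= [(w, y).2]/= addrA.
have := yP k; have := ysP k; rewrite [map _ (w :: W)]/=.
set a := itlim (_ :: _) _; set b := itlim _ _; set c := `|v k + _ + _|.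
move=> h1 h2; rewrite (le_lt_trans (ler_distD b _ _))//.
by rewrite [ltRHS]splitr ltrD.
Qed.

End IteratedLimit.

(** * James's oscillating sequences and their staggered averages *)

Section Waves.
Context {R : realType}.
Implicit Types (s : R) (cs : seq R).

(* James's oscillating vectors: [cs] stands for the step function given by its tail
   sums, which takes values of alternating signs and absolute value at least 1. *)
Fixpoint alternating (n : nat) s cs : Prop :=
  1 <= s * (\sum_(c <- cs) c) /\
  if n is n'.+1 then
    exists pre post, cs = pre ++ post /\ alternating n' (- s) post
  else True.

Definition wave n s cs := exists pre post, cs = pre ++ post /\ alternating n s post.

Lemma alternating_sum n s cs : alternating n s cs -> 1 <= s * (\sum_(c <- cs) c).
Proof. by case: n => [|n] []. Qed.

Lemma wave_cat n s pre cs : wave n s cs -> wave n s (pre ++ cs).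
Proof.
by move=> [pre' [post [-> alt]]]; exists (pre ++ pre'), post; rewrite catA.
Qed.

(** The sequence is [2 s, - 2 s, 2 s, ...] with a last term of absolute value 1: its tail sums
    alternate between [s] and [- s]. The bound on the absolute values makes the constants [K n] grow
    at most linearly. *)
Lemma alternating_exists n s : s * s = 1 -> exists cs,
  [/\ alternating n s cs, \sum_(c <- cs) c = s &
      \sum_(c <- cs) `|c| <= 2 * n.+1%:R].
Proof.
elim: n s => [|n IH] s ss.
all: have ns : `|s| = 1 by
  apply/eqP; rewrite -(@eqrXn2 _ 2)// expr1n -normrX expr2 ss normr1.
  exists [:: s]; rewrite !big_cons !big_nil !addr0 ns; split=> //=; last by lra.
  by rewrite big_cons big_nil addr0 ss.
have [|cs [alt cs_sum cs_norm]] := IH (- s); first by rewrite mulrNN.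
have sum2 : \sum_(c <- (2 * s) :: cs) c = s by rewrite big_cons cs_sum; ring.
exists ((2 * s) :: cs); split => //.
  split; first by rewrite sum2 ss.
  by exists [:: 2 * s], cs.
rewrite big_cons normrM ns mulr1 ger0_norm// -[X in _ <= 2 * X]natr1 mulrDr mulr1.
by rewrite addrC lerD2r.
Qed.

(* [m] staggered copies of the block [b], stored columnwise: the [i]-th copy
   occupies the slot [i] of [r]. *)
Definition slots (r : seq nat) (b : seq R) : seq (nat -> R) :=
  flatten [seq [seq (fun i' => if i' == i then c else 0) | c <- b] | i <- r].

Lemma slots_filter r b i : uniq r ->
  [seq c <- [seq w i | w <- slots r b] | c != 0] =
  if i \in r then [seq c <- b | c != 0] else [::].
Proof.
elim: r => //= j r IH /andP[jr ur]; rewrite /slots/= map_cat filter_cat.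
rewrite [X in _ ++ X](IH ur) -map_comp inE.
have [->|ij] := eqVneq i j.
  rewrite (negbTE jr) cats0 /=.
  by elim: (b) => //= c b' ->; rewrite eqxx.
rewrite [X in X ++ _](_ : _ = [::])//.
by elim: (b) => //= c b' ->; rewrite (negbTE ij) eqxx.
Qed.

Lemma sum_filter_neq0 cs : \sum_(c <- [seq c <- cs | c != 0]) c = \sum_(c <- cs) c.
Proof.
rewrite big_filter [RHS](bigID (fun c => c != 0))/= [X in _ + X]big1 ?addr0//.
by move=> c; rewrite negbK => /eqP.
Qed.

Definition signed_mean (m j : nat) (w : nat -> R) : R :=
  m%:R^-1 * \sum_(i < m) (-1) ^+ (i < j)%N * w i.

Lemma sum_signed_mean m j W : \sum_(w <- W) signed_mean m j w =
  m%:R^-1 * \sum_(i < m) (-1) ^+ (i < j)%N * \sum_(w <- W) w i.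
Proof.
rewrite -mulr_sumr exchange_big/=; congr (_ * _).
by apply: eq_bigr => i _; rewrite mulr_sumr.
Qed.

(* Just before the slot [j] of a block, the copies [i < j] have already passed to
   the next tail of [cs], of opposite sign, and the other ones have not: after the
   change of sign of the copies [i < j] all tails agree. *)
Lemma alternating_stagger m n s cs : (0 < m)%N -> alternating n s cs ->
  exists W : seq (nat -> R),
    (forall i, (i < m)%N ->
       [seq c <- [seq w i | w <- W] | c != 0] = [seq c <- cs | c != 0]) /\
    (forall j, (j <= m)%N ->
       if n is n'.+1 then wave n' s [seq signed_mean m j w | w <- W] else True).
Proof.
move=> m0; elim: n s cs => [|n IH] s cs alt.
  exists (slots (iota 0 m) cs); split=> // i im.
  by rewrite slots_filter ?iota_uniq// mem_iota im.
have [s1 [b [cs1 [csE alt1]]]] := alt.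
have [W1 [W1f W1w]] := IH _ _ alt1.
exists (slots (iota 0 m) b ++ W1); split=> [i im|j jm].
  rewrite map_cat filter_cat slots_filter ?iota_uniq// mem_iota im/= W1f//.
  by rewrite csE filter_cat.
have -> : slots (iota 0 m) b = slots (iota 0 j) b ++ slots (iota j (m - j)) b.
  by rewrite /slots -flatten_cat -map_cat -{3}[j]add0n -iotaD subnKC.
rewrite -catA map_cat; apply: wave_cat.
set P := slots _ _ ++ W1.
have sumP i : (i < m)%N -> \sum_(w <- P) w i =
    if (i < j)%N then \sum_(c <- cs1) c else \sum_(c <- cs) c.
  move=> im; rewrite -(big_map (fun w : nat -> R => w i) xpredT idfun)/=.
  rewrite -sum_filter_neq0 /P map_cat filter_cat slots_filter ?iota_uniq// W1f//.
  rewrite mem_iota subnKC// im andbT csE; case: ltnP => ij /=.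
    by rewrite sum_filter_neq0.
  by rewrite -filter_cat sum_filter_neq0.
have comb_ge : 1 <= s * \sum_(c <- [seq signed_mean m j w | w <- P]) c.
  rewrite big_map sum_signed_mean mulrCA ler_pdivlMl ?ltr0n// mulr1.
  rewrite -[X in X%:R]card_ord -sumr_const mulr_sumr; apply: ler_sum => i _.
  rewrite sumP//; have := alternating_sum _ _ _ alt1.
  by case: ltnP => _ /=; rewrite ?expr1 ?expr0 ?mul1r// mulN1r mulrN mulNr.
exists [::], [seq signed_mean m j w | w <- P]; split=> //.
case: n IH alt alt1 W1w => [|n] IH alt alt1 W1w; first by split.
split=> //; have [pre [post [E wp]]] := W1w j jm.
exists ([seq signed_mean m j w | w <- slots (iota j (m - j)) b] ++ pre), post.
by split=> //; rewrite /P map_cat E catA.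
Qed.

(** The coefficients before the oscillation get slots too, so that each copy is the whole of [cs]
    with zeros inserted and has the same norm by [itlim_filter]. *)
Lemma wave_stagger m n s cs : (0 < m)%N -> wave n.+1 s cs ->
  exists W : seq (nat -> R),
    (forall i, (i < m)%N ->
       [seq c <- [seq w i | w <- W] | c != 0] = [seq c <- cs | c != 0]) /\
    (forall j, (j <= m)%N -> wave n s [seq signed_mean m j w | w <- W]).
Proof.
move=> m0 [pre [post [-> alt]]].
have [W [Wf Ww]] := alternating_stagger m _ _ _ m0 alt.
exists (slots (iota 0 m) pre ++ W); split=> [i im|j jm].
  by rewrite map_cat !filter_cat slots_filter ?iota_uniq// mem_iota im Wf.
by rewrite map_cat; apply: wave_cat; exact: Ww.
Qed.

(** Otherwise [K] grows geometrically with ratio at least [q^-1], against the linear bound. *)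
Lemma slow_growth (K : nat -> R) (a b q : R) : 0 < a -> (forall n, a <= K n) ->
  (forall n, K n <= b * n.+1%:R) -> 0 < q < 1 -> exists n, q * K n.+1 <= K n.
Proof.
move=> a0 Ka Kb /andP[q0 q1]; apply: contrapT => H.
have Hn n : K n < q * K n.+1.
  by rewrite ltNge; apply/negP => h; apply: H; exists n.
have qn n : a <= q ^+ n * K n.
  elim: n => [|n IH]; first by rewrite mul1r.
  by rewrite (le_trans IH)// exprSr -mulrA ler_wpM2l ?exprn_ge0 ?ltW.
pose h := q^-1 - 1.
have h0 : 0 < h by rewrite subr_gt0 invf_gt1.
have bern n : 1 + n%:R * h <= q^-1 ^+ n.
  elim: n => [|n IH]; first by rewrite mul0r addr0.
  have q10 : 0 <= q^-1 by rewrite invr_ge0 ltW.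
  rewrite exprSr; apply: le_trans (ler_wpM2r q10 IH).
  have -> : q^-1 = 1 + h by rewrite /h; ring.
  rewrite -natr1; have : 0 <= n%:R * h * h by rewrite !mulr_ge0// ltW.
  by move: (n%:R) => x; lra.
have b0 : 0 < b.
  by have := le_trans (Ka 0%N) (Kb 0%N); rewrite mulr1; exact: lt_le_trans.
(* Bernoulli's inequality is only linear in [n]; squaring it, that is, working at [n + n], gives a
   quadratic lower bound that beats [3 b n]. *)
have [n n0 nP] : exists2 n, (0 < n)%N & 6 * b < n%:R * (a * h ^+ 2).
  exists (Num.truncn (6 * b / (a * h ^+ 2))).+1 => //.
  by rewrite -ltr_pdivrMr ?mulr_gt0 ?exprn_gt0// truncnS_gt.
have := qn (n + n)%N; have := Kb (n + n)%N.
move=> k1 k2.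
have : a * (q^-1 ^+ (n + n)) <= K (n + n)%N.
  by rewrite exprVn ler_pdivrMr ?exprn_gt0// [leRHS]mulrC.
rewrite exprD => k3.
have nh0 : 0 <= 1 + n%:R * h by rewrite addr_ge0// mulr_ge0// ltW.
have k4 := ler_wpM2l (ltW a0) (ler_pM nh0 nh0 (bern n) (bern n)).
have n1 : 1 <= n%:R :> R by rewrite ler1n.
have k5 : b * (n + n).+1%:R <= b * (3 * n%:R).
  by rewrite (ler_wpM2l (ltW b0))// -natr1 natrD; lra.
move: (le_trans k4 (le_trans k3 (le_trans k1 k5))) nP.
move: (n%:R) n1 h0 => x x1 h0' k6 k7.
have : x * (6 * b) <= x * (x * (a * h ^+ 2)) by rewrite ler_wpM2l// ?ltW//; lra.
have : 0 <= a * x * h by rewrite !mulr_ge0// ltW//; lra.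
have : 0 < b * x by rewrite mulr_gt0//; lra.
move: k6; rewrite expr2; lra.
Qed.

End Waves.

(** * Sign separation, that is, the failure of J-convexity, for non-superreflexive spaces *)

Definition sign_separated {R : realType} (X : normedModType R) : Prop :=
  forall (m : nat) (delta : R), 0 < delta -> exists x : nat -> X,
    (forall i, `|x i| <= 1) /\
    forall j, (j <= m)%N -> m%:R - delta <= `|\sum_(i < m) (-1) ^+ (i < j)%N *: x i|.

Section NonreflexiveSigns.
Context {R : realType}.

Lemma nonreflexive_sign_separated (X : completeNormedModType R) :
  ~ reflexive_space X -> sign_separated X.
Proof.
move=> nrX; have [F nF] : exists F : dual (dual X), ~ exists x, forall f, F f = f x.
  apply: contrapT => H; apply: nrX => F; apply: contrapT => nF.
  by apply: H; exists F.
have [theta theta0 sepF] := nonreflexive_annihilator F nF.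
have [U [UU UM UF]] := weak_star_ultrafilter F.
set M := `|F| + 1 in UM.
have M0 : 0 < M by rewrite ltr_wpDl.
have sep v : exists (f : dual X) (tau : R),
    [/\ `|f| <= 1, f v = 0, (f y : R) @[y --> U] --> tau & theta <= `|tau|].
  by have [f [f1 fv tF]] := sepF v; exists f, (F f); split=> //; exact: UF.
pose N cs := itlim U cs (0 : X).
pose K n := inf [set N cs | cs in wave n 1].
have N_ge n cs : wave n 1 cs -> theta <= N cs.
  move=> [pre [post [-> alt]]].
  apply: le_trans (itlim_lower _ UU _ UM _ (ltW theta0) sep pre post 0).
  rewrite -[leLHS]mulr1 (ler_wpM2l (ltW theta0))//.
  have := alternating_sum _ _ _ alt; rewrite mul1r => /le_trans; apply.
  exact: ler_norm.
have K_le n cs : wave n 1 cs -> K n <= N cs.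
  move=> wcs; apply: ge_inf; last by exists cs.
  by exists theta => _ [ds wds <-]; exact: N_ge wds.
have Kwit n : exists2 cs, wave n 1 cs & N cs <= 2 * M * n.+1%:R.
  have [cs [alt _ cs_norm]] := alternating_exists n (1 : R) (mulr1 1).
  exists cs; first by exists [::], cs.
  rewrite (le_trans (itlim_le _ UU _ UM _ _))// normr0 add0r (mulrC 2) -mulrA.
  exact: ler_wpM2l (ltW M0) _ _ cs_norm.
have K_ge n : theta <= K n.
  apply: lb_le_inf; first by have [cs wcs _] := Kwit n; exists (N cs), cs.
  by move=> _ [cs wcs <-]; exact: N_ge wcs.
have K_lin n : K n <= 2 * M * n.+1%:R.
  by have [cs wcs] := Kwit n; exact: le_trans (K_le _ _ wcs).
move=> m delta delta0.
have [->|m0] := posnP m.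
  exists (fun=> 0); split=> [i|j _]; first by rewrite normr0.
  by rewrite big_ord0 normr0; lra.
have mR0 : 0 < m%:R :> R by rewrite ltr0n.
(* To first order the relative losses add up to [4 d]: two from comparing [K n] with [kap], one from
   the approximation of the signed means, one from the normalization. The factor 5 leaves room for
   higher orders. *)
pose d := Num.min (1 / 2) (delta / (5 * m%:R)).
have d0 : 0 < d by rewrite lt_min !divr_gt0// mulr_gt0.
have d1 : d <= 1 / 2 by rewrite ge_min lexx.
have dm : 5 * d * m%:R <= delta.
  by rewrite -mulrA mulrCA -ler_pdivlMr ?mulr_gt0// ge_min lexx orbT.
have [n Kn] : exists n, (1 - d) * K n.+1 <= K n.
  by apply: (@slow_growth _ K theta (2 * M)) => //; apply/andP; split; lra.
have [cs wcs Ncs] : exists2 cs, wave n.+1 1 cs & N cs < (1 + d) * K n.+1.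
  have : K n.+1 < (1 + d) * K n.+1.
    by rewrite ltr_pMl ?ltrDl// (lt_le_trans theta0).
  move=> /inf_lt[|_ [cs wcs <-] h]; last by exists cs.
  by have [cs wcs _] := Kwit n.+1; exists (N cs), cs.
have [W [Wf Ww]] := wave_stagger m _ _ _ m0 wcs.
set kap := N cs in Ncs.
have kap0 : 0 < kap by rewrite (lt_le_trans theta0)// (N_ge _ _ wcs).
have eta0 : 0 < d * kap by rewrite mulr_gt0.
(* The copies and their signed means are indexed together, so that the same vectors [ys] realize all
   of them. *)
pose phi (k : 'I_m + 'I_m.+1) (w : nat -> R) : R :=
  match k with inl i => w i | inr j => signed_mean m j w end.
have [ys sys ysP] := itlim_approx _ UU _ UM W phi (fun=> 0) _ eta0.
pose x0 i : X := \sum_(p <- zip W ys) p.1 i *: p.2.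
have x0_le i : (i < m)%N -> `|x0 i| <= kap * (1 + d).
  move=> im; have := ysP (inl (Ordinal im)).
  have -> : [seq phi (inl (Ordinal im)) w | w <- W] = [seq w i | w <- W].
    by [].
  rewrite -(itlim_filter _ UU) Wf// (itlim_filter _ UU) -/(N cs) -/kap add0r.
  have -> : \sum_(p <- zip W ys) phi (inl (Ordinal im)) p.1 *: p.2 = x0 i.
    by [].
  by rewrite distrC ltr_distl => /andP[_ /ltW]; rewrite mulrDr mulr1 (mulrC d).
(* The signed means are still waves of order [n], so their limit norm is at least [K n]. *)
have comb_ge j : (j <= m)%N ->
    m%:R * (K n - d * kap) <= `|\sum_(i < m) (-1) ^+ (i < j)%N *: x0 i|.
  move=> jm; have := ysP (inr (inord j)).
  have -> : [seq phi (inr (inord j)) w | w <- W] = [seq signed_mean m j w | w <- W].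
    by apply: eq_map => w; rewrite /phi /= inordK.
  rewrite add0r.
  have -> : \sum_(p <- zip W ys) phi (inr (inord j)) p.1 *: p.2 =
      m%:R^-1 *: \sum_(i < m) (-1) ^+ (i < j)%N *: x0 i.
    rewrite scaler_sumr; under [RHS]eq_bigr do rewrite 2!scaler_sumr.
    rewrite exchange_big/=; apply: eq_bigr => p _.
    rewrite /phi /= inordK// /signed_mean -scalerA scaler_suml scaler_sumr.
    by apply: eq_bigr => i _; rewrite !scalerA mulrA.
  rewrite normrZ normfV (ger0_norm (ler0n _ m)) distrC ltr_distl => /andP[/ltW h _].
  rewrite -ler_pdivlMl//; apply: le_trans h.
  by rewrite lerD2r; apply: K_le; exact: Ww.
have D0 : 0 < kap * (1 + d) by rewrite mulr_gt0// ltr_wpDl.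
(* Dividing by the upper bound of the norms brings the vectors into the unit ball; beyond [m], where
   [x0] is not controlled, the sequence is padded with 0. *)
exists (fun i => if (i < m)%N then (kap * (1 + d))^-1 *: x0 i else 0).
split=> [i|j jm].
  case: ifPn => im; last by rewrite normr0.
  by rewrite normrZ normfV (gtr0_norm D0) ler_pdivrMl// mulr1 x0_le.
have -> : \sum_(i < m) (-1) ^+ (i < j)%N *:
    (if (i < m)%N then (kap * (1 + d))^-1 *: x0 i else 0) =
    (kap * (1 + d))^-1 *: \sum_(i < m) (-1) ^+ (i < j)%N *: x0 i.
  rewrite scaler_sumr; apply: eq_bigr => i _.
  by rewrite ltn_ord !scalerA mulrC.
rewrite normrZ normfV (gtr0_norm D0) ler_pdivlMl//.
apply: le_trans (comb_ge j jm).
have Kk : (1 - d) * kap <= (1 + d) * K n.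
  apply: le_trans (_ : (1 - d) * ((1 + d) * K n.+1) <= _).
    by rewrite ler_wpM2l ?(ltW Ncs)//; lra.
  by rewrite mulrCA ler_wpM2l//; lra.
have H1 : (1 + d) * (m%:R * (K n - d * kap)) >= m%:R * kap * (1 - 2 * d - d * d).
  have := ler_wpM2l (ltW mR0) Kk; lra.
have d10 : 0 < 1 + d by lra.
rewrite -(ler_pM2l d10); apply: le_trans H1.
have -> : (1 + d) * (kap * (1 + d) * (m%:R - delta)) =
  kap * ((1 + d) * (1 + d) * (m%:R - delta)) by ring.
have -> : m%:R * kap * (1 - 2 * d - d * d) =
  kap * (m%:R * (1 - 2 * d - d * d)) by ring.
rewrite (ler_wpM2l (ltW kap0))//.
have : (1 + d) * (1 + d) * (m%:R - delta) <= (1 + d) * (1 + d) * (m%:R * (1 - 5 * d)).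
  have dd0 : 0 <= (1 + d) * (1 + d) by rewrite mulr_ge0 // ltW.
  by rewrite (ler_wpM2l dd0)//; lra.
move=> /le_trans; apply.
rewrite mulrCA (ler_wpM2l (ltW mR0))//.
have : 0 <= d * d by rewrite mulr_ge0 ?ltW.
have : 0 <= d * d * d by rewrite !mulr_ge0 ?ltW.
lra.
Qed.

Lemma finitely_representable_sign_separated (X Y : normedModType R) :
  finitely_representable X Y -> sign_separated X -> sign_separated Y.
Proof.
move=> XY sX m delta delta0.
have delta20 : 0 < delta / 2 by rewrite divr_gt0.
have [x [x1 xP]] := sX m _ delta20.
(* Rescaling by [1 + eps] costs at most [eps * m <= delta / 2]; the [+ 1] keeps the denominator
   positive when [m = 0]. *)
pose eps := delta / 2 / (m%:R + 1).
have m10 : 0 < m%:R + 1 :> R by rewrite ltr_wpDl.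
have eps0 : 0 < eps by rewrite divr_gt0.
have epsm : eps * m%:R <= delta / 2.
  rewrite /eps -mulrA ger_pMr// mulrC ler_pdivrMr// mul1r; lra.
pose b (i : 'I_m) := x i.
have [T [Tlin Tiso]] := XY m b eps eps0.
have span_b i : fin_span b (b i).
  exists (fun j => (j == i)%:R) => //; rewrite (bigD1 i)//= eqxx scale1r.
  by rewrite big1 ?addr0// => j /negbTE ->; rewrite scale0r.
have span0 : fin_span b 0.
  by exists (fun=> 0) => //; rewrite big1// => i _; rewrite scale0r.
have T0 : T 0 = 0.
  have := Tlin 1 0 0 span0 span0; rewrite !scale1r addr0 => /eqP.
  by rewrite -subr_eq0 opprD addrA subrr sub0r oppr_eq0 => /eqP.
have Tsum (a : 'I_m -> R) : fin_span b (\sum_i a i *: b i) /\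
    T (\sum_i a i *: b i) = \sum_i a i *: T (b i).
  split; first by exists a.
  suff : forall r : seq 'I_m, fin_span b (\sum_(i <- r) a i *: b i) /\
      T (\sum_(i <- r) a i *: b i) = \sum_(i <- r) a i *: T (b i).
    by case/(_ (index_enum _)).
  elim=> [|i r [sp IH]]; first by rewrite !big_nil.
  rewrite !big_cons; split; last by rewrite Tlin// IH.
  have [c _ <-] := sp; exists (fun j => a i * (j == i)%:R + c j) => //.
  under eq_bigr do rewrite scalerDl; rewrite big_split/=; congr (_ + _).
  rewrite (bigD1 i)//= eqxx mulr1 big1 ?addr0// => j /negbTE ->.
  by rewrite mulr0 scale0r.
have e10 : 0 < 1 + eps by rewrite ltr_wpDl.
exists (fun i => if (i < m)%N then (1 + eps)^-1 *: T (x i) else 0).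
split=> [i|j jm].
  case: ifPn => im; last by rewrite normr0.
  rewrite normrZ normfV (gtr0_norm e10) ler_pdivrMl// mulr1.
  have /andP[_ h] := Tiso _ (span_b (Ordinal im)); apply: le_trans h _.
  by rewrite -[leRHS]mulr1 (ler_wpM2l (ltW e10)) // x1.
have [sp TE] := Tsum (fun i : 'I_m => (-1) ^+ (i < j)%N).
have -> : \sum_(i < m) (-1) ^+ (i < j)%N *:
    (if (i < m)%N then (1 + eps)^-1 *: T (x i) else 0) =
    (1 + eps)^-1 *: T (\sum_(i < m) (-1) ^+ (i < j)%N *: b i).
  rewrite TE scaler_sumr; apply: eq_bigr => i _.
  by rewrite ltn_ord !scalerA mulrC.
rewrite normrZ normfV (gtr0_norm e10) ler_pdivlMl//.
have /andP[h _] := Tiso _ sp; apply: le_trans h; apply: le_trans (xP j jm).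
have : 0 <= eps * delta by rewrite mulr_ge0 ?ltW.
lra.
Qed.

Theorem nonsuperreflexive_sign_separated (Y : normedModType R) :
  ~ superreflexive Y -> sign_separated Y.
Proof.
move=> nY; apply: contrapT => nsY; apply: nY => X XY.
apply: contrapT => /nonreflexive_sign_separated sX; apply: nsY.
exact: finitely_representable_sign_separated XY sX.
Qed.

End NonreflexiveSigns.

(** * Diamond graphs *)

Section GraphHom.

Definition hom (G H : graph) :=
  {f : vert G -> vert H | forall x y, adj x y -> adj (f x) (f y)}.

Fact edge_map_proof G H (f : hom G H) (e : edge G) :
  exists u v, adj u v /\ sval f @` sval e = [set u; v].
Proof.
case: e => _ /= [u [v [uv ->]]]; exists (sval f u), (sval f v).
split; first exact: (svalP f).
by rewrite image_setU !image_set1.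
Qed.

Definition edge_map G H (f : hom G H) (e : edge G) : edge H :=
  exist _ (sval f @` sval e) (edge_map_proof _ _ f e).

Definition step_map G H (f : hom G H) (v : vert (diamond_step G)) :
    vert (diamond_step H) :=
  match v with
  | inl u => inl (sval f u)
  | inr (e, n) => inr (edge_map _ _ f e, n)
  end.

Fact step_map_adj G H (f : hom G H) x y :
  adj x y -> adj (step_map _ _ f x) (step_map _ _ f y).
Proof.
by case: x => [u|[e n]]; case: y => [w|[e' n']] //= h; [exists u|exists w].
Qed.

(** Subdivision is functorial, which allows the copies of [diamond k] in [diamond k.+1] to be
    defined by recursion on [k]. *)
Definition step_hom G H (f : hom G H) : hom (diamond_step G) (diamond_step H) :=
  exist _ (step_map _ _ f) (step_map_adj _ _ f).

Fixpoint walk (G : graph) (l : nat) (x y : vert G) : Prop :=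
  if l is l'.+1 then exists2 z, adj x z & walk G l' z y else x = y.

Lemma walk_trans G l l' (x y z : vert G) :
  walk G l x y -> walk G l' y z -> walk G (l + l') x z.
Proof.
elim: l x => [x -> //|l IH x [w xw wy] yz].
by exists w => //; exact: IH.
Qed.

Lemma walk_hom G H (f : hom G H) l x y :
  walk G l x y -> walk H l (sval f x) (sval f y).
Proof.
elim: l x => [x -> //|l IH x [z xz zy]].
by exists (sval f z); [exact: (svalP f)|exact: IH].
Qed.

Lemma walk_path G l (x y : vert G) : walk G l x y -> exists s,
  [/\ path (fun u v => `[< adj u v >]) x s, last x s = y & size s = l].
Proof.
elim: l x => [x <-|l IH x [z xz /IH[s [ps ls ss]]]]; first by exists [::].
by exists (z :: s); split=> //=; [apply/andP; split=> //; exact/asboolP|rewrite ss].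
Qed.

End GraphHom.

(** * Self-similarity of the diamonds and codes of their vertices *)

Section Diamond.

Lemma diamond_adj_sym k (x y : vert (diamond k)) : adj x y -> adj y x.
Proof.
case: k x y => [x y xy|k]; first exact: (fun yx => xy (esym yx)).
by move=> [u|[e n]] [w|[e' n']].
Qed.

Lemma walk_sym k l (x y : vert (diamond k)) :
  walk _ l x y -> walk _ l y x.
Proof.
elim: l x => [x -> //|l IH x [z xz /IH zy]].
rewrite -addn1; apply: walk_trans zy _; exists x => //; exact: diamond_adj_sym.
Qed.

Fixpoint pole (b : bool) k : vert (diamond k) :=
  match k with 0 => b | k'.+1 => inl (pole b k') end.

Fact base_edge_proof : exists u v : vert (diamond 0),
  adj u v /\ [set false; true] = [set u; v].
Proof. by exists false, true; split=> // e; exact: (notF (esym e)). Qed.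

Definition base_edge : edge (diamond 0) := exist _ [set false; true] base_edge_proof.

Lemma base_edge_uniq (e : edge (diamond 0)) : e = base_edge.
Proof.
case: e => e [u [v [uv eE]]]; apply: eq_exist; rewrite {}eE.
move: u v uv => [] [] // _; first exact: setUC.
Qed.

(* [diamond k.+1] is the union of copies of [diamond k], each of which lies between
   the [n]-th middle vertex and the bottom pole ([diamond_half k n false]) or the top
   pole ([diamond_half k n true]). *)
Definition half0_map (n : nat) (s : bool) (b : vert (diamond 0)) : vert (diamond 1) :=
  if b == s then inl s else inr (base_edge, n).

Fact half0_adj n s (x y : vert (diamond 0)) :
  adj x y -> adj (half0_map n s x) (half0_map n s y).
Proof.
rewrite /half0_map; case: s; case: x; case: y => //= _; by [left|right].
Qed.

Fixpoint diamond_half k n s : hom (diamond k) (diamond k.+1) :=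
  match k with
  | 0 => exist _ (half0_map n s) (half0_adj n s)
  | k'.+1 => step_hom _ _ (diamond_half k' n s)
  end.

Lemma half_pole k n s : sval (diamond_half k n s) (pole s k) = pole s k.+1.
Proof.
by elim: k => [|k IH]; [rewrite /= /half0_map eqxx|rewrite [LHS]/= IH].
Qed.

Lemma half_middle k n : sval (diamond_half k n false) (pole true k) =
  sval (diamond_half k n true) (pole false k).
Proof. by elim: k => [//|k IH]; rewrite [LHS]/= IH. Qed.

Lemma adj_stepP (G : graph) (x y : vert (diamond_step G)) : adj x y ->
  (exists u e n, [/\ x = inl u, y = inr (e, n) & sval e u]) \/
  (exists u e n, [/\ y = inl u, x = inr (e, n) & sval e u]).
Proof.
by case: x y => [u|[e n]] [w|[e' n']] //= h; [left|right];
  [exists u, e', n'|exists w, e, n].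
Qed.

Definition edge_in_half k (x y : vert (diamond k.+1)) :=
  exists n s (x' y' : vert (diamond k)), [/\ adj x' y',
    x = sval (diamond_half k n s) x' & y = sval (diamond_half k n s) y'].

Lemma edge_in_half_sym k x y : edge_in_half k x y -> edge_in_half k y x.
Proof.
move=> [n [s [x' [y' [a b c]]]]]; exists n, s, y', x'; split=> //.
exact: diamond_adj_sym.
Qed.

(** The graph is defined by subdividing each edge of a smaller diamond; here it is seen as glued
    from copies of that diamond. An edge one level up comes from subdividing an edge [e]; the copy
    containing [e] also contains its subdivision. *)
Lemma adj_half_cover k (x y : vert (diamond k.+1)) : adj x y -> edge_in_half k x y.
Proof.
(* By symmetry the first end may be taken to be the old vertex. *)
have red j : (forall u (e : edge (diamond j)) n, sval e u ->
    edge_in_half j (inl u) (inr (e, n))) -> forall x y, adj x y -> edge_in_half j x y.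
  move=> H x' y' /adj_stepP[] [u [e [n [-> -> eu]]]]; first exact: H.
  by apply: edge_in_half_sym; exact: H.
elim: k x y => [|k IH]; apply: red => u e n eu.
  exists n, u, u, (~~ u); rewrite (base_edge_uniq e) /= /half0_map eqxx.
  by case: (u).
case: e eu => e eP /= eu; have [a [b [ab eE]]] := eP.
have [n0 [s [a' [b' [ab' aE bE]]]]] := IH _ _ ab.
have e'P : exists u v, adj u v /\ [set a'; b'] = [set u; v] by exists a', b'.
have [u' uE eu'] : exists2 u', u = sval (diamond_half k n0 s) u' & [set a'; b'] u'.
  by move: eu; rewrite eE => -[->|->]; [exists a' => //; left|exists b' => //; right].
exists n0, s, (inl u'), (inr (exist _ [set a'; b'] e'P : edge (diamond k), n)).
split => //=; first by rewrite uE.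
congr (inr (_, n)); apply: eq_exist => /=.
by rewrite eE image_setU !image_set1 aE bE.
Qed.

Lemma half_cover k (x : vert (diamond k.+1)) :
  exists n s x', x = sval (diamond_half k n s) x'.
Proof.
suff [y /adj_half_cover[n [s [x' [y' [_ xE _]]]]]] : exists y, adj x y.
  by exists n, s, x'.
elim: k x => [|k IH] [u|[e n]].
- exists (inr (base_edge, 0%N)); by case: u; [right|left].
- have [a [b [ab eE]]] := svalP e; exists (inl a) => /=; rewrite eE; by left.
- have [w uw] := IH u.
  have eP : exists a b, adj a b /\ [set u; w] = [set a; b] by exists u, w.
  by exists (inr (exist _ [set u; w] eP : edge (diamond k.+1), 0%N)); left.
- have [a [b [ab eE]]] := svalP e; exists (inl a) => /=; rewrite eE; by left.
Qed.

(* The vertex [x] will be mapped to the sum of the vectors [x_i] for which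
   [code k r x i] holds, [r] being the outcome of the coin tosses. An edge is sent
   to one vector; when it is subdivided, the vector [x_i] is split into the halves
   [2 i] and [2 i + 1], the [n]-th toss deciding which one comes first on the way
   through the [n]-th new vertex. *)
Fixpoint code k (r : nat -> bool) : vert (diamond k) -> nat -> bool :=
  match k with
  | 0 => fun b _ => b
  | k'.+1 => fun x i =>
    match x with
    | inl u => code k' r u i./2
    | inr (e, n) =>
      `[< forall u, sval e u -> code k' r u i./2 >] ||
      `[< exists2 u, sval e u & code k' r u i./2 >] && (odd i == r n)
    end
  end.

Lemma code_edge k r (a b : vert (diamond k)) (e : edge (diamond k)) n i :
  sval e = [set a; b] -> code k.+1 r (inr (e, n)) i =
  (code k r a i./2 && code k r b i./2) ||
  (code k r a i./2 || code k r b i./2) && (odd i == r n).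
Proof.
move=> eE /=; congr (_ || _ && _).
  apply/asboolP/andP => [H|[ha hb] u]; last by rewrite eE => -[] ->.
  by split; apply: H; rewrite eE; [left|right].
apply/asboolP/orP => [[u]|[] h].
- by rewrite eE => -[] ->; [left|right].
- by exists a => //; rewrite eE; left.
- by exists b => //; rewrite eE; right.
Qed.

(** This yields the Lipschitz bound. A new vertex takes one of the two halves of the only index on
    which the ends of its edge may disagree, so it differs from each end in at most one half. *)
Lemma code_adj k r (x y : vert (diamond k)) : adj x y ->
  exists i0, forall i, (i < 2 ^ k)%N -> i != i0 -> code k r x i = code k r y i.
Proof.
elim: k x y => [|k IH] x y.
  by move=> _; exists 0%N => -[].
have step u (e : edge (diamond k)) n : sval e u -> exists i0, forall i,
    (i < 2 ^ k.+1)%N -> i != i0 -> code k.+1 r (inl u) i = code k.+1 r (inr (e, n)) i.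
  move=> eu; have [w [uw eE]] : exists w, adj u w /\ sval e = [set u; w].
    have [a [b [ab eE]]] := svalP e; move: eu; rewrite eE => -[] ->.
      by exists b.
    by exists a; rewrite setUC; split=> //; exact: diamond_adj_sym.
  have [i0 E] := IH _ _ uw.
  (* The half by which [u] and the new vertex can differ: the one chosen by [r n] if the code of [u]
     lacks [i0], the other one if it contains [i0]. *)
  exists (i0.*2 + (code k r u i0 (+) r n))%N => i ik ii0.
  rewrite (code_edge _ _ _ _ _ _ _ eE) [LHS]/=.
  have [i2|i2] := eqVneq i./2 i0; last first.
    rewrite -(E i./2) // ?ltn_half_double -?mul2n -?expnS//.
    by case: (code k r u i./2).
  have : odd i != code k r u i0 (+) r n.
    by apply: contra ii0 => /eqP <-; rewrite -i2 addnC odd_double_half.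
  rewrite i2; case: (code k r u i0); case: (code k r w i0); case: (odd i);
    by case: (r n).
move=> /adj_stepP[] [u [e [n [-> -> eu]]]]; first exact: step.
by have [i0 E] := step u e n eu; exists i0 => i ik /E ->.
Qed.

(** The first subdivision decides the leading bit [b], later ones append bits at the end. On the way
    through the [n]-th middle vertex the bottom copy fills the block [r n] while the other is empty;
    the top copy fills the other block once [r n] is full. *)
Lemma code_half k r n s (x : vert (diamond k)) (b : bool) i : (i < 2 ^ k)%N ->
  code k.+1 r (sval (diamond_half k n s) x) (b * 2 ^ k + i) =
  if b == r n (+) s then code k r x i else s.
Proof.
elim: k x i => [|k IH] x i.
  rewrite expn0 ltnS leqn0 => /eqP ->; rewrite addn0 muln1.
  have E : code 1 r (inr (base_edge, n)) b = (odd b == r n).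
    by rewrite (code_edge 0 _ false true).
  have -> : sval (diamond_half 0 n s) x = half0_map n s x by [].
  move: x => /= x; rewrite /half0_map.
  have [->|xs] := eqVneq x s; first by case: ifP.
  have {xs} -> : x = ~~ s by move: xs; case: x; case: (s).
  move: E => /= ->.
  by case: b; case: (s); case: (r n).
move=> ik.
have ik2 : (i./2 < 2 ^ k)%N by rewrite ltn_half_double -mul2n -expnS.
have h2 : (b * 2 ^ k.+1 + i)./2 = (b * 2 ^ k + i./2)%N.
  by rewrite expnS mulnCA mul2n halfD doubleK odd_double.
have ho : odd (b * 2 ^ k.+1 + i) = odd i.
  by rewrite expnS mulnCA mul2n oddD odd_double.
case: x => [u|[e m]].
  rewrite -[LHS]/(code k.+1 r (sval (diamond_half k n s) u) (b * 2 ^ k.+1 + i)./2).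
  by rewrite h2 IH.
have [a [c [_ eE]]] := svalP e.
rewrite [sval (diamond_half k.+1 n s) _]/=.
rewrite (code_edge k.+1 _ (sval (diamond_half k n s) a) (sval (diamond_half k n s) c)).
  by rewrite (code_edge k _ a c)// ho h2 !IH//; case: ifP => // _; case: (s).
by rewrite /= eE image_setU !image_set1.
Qed.

End Diamond.

(** * Lower bounds for signed sums of code differences *)

Section Separation.

(** Integer values let [lia] settle the case analyses on tosses and heights. *)
Definition cut_sum (N j : nat) (f : nat -> int) : int :=
  \sum_(i < N) (-1) ^+ (i < j)%N * f i.

Lemma cut_sum0 N f : cut_sum N 0 f = \sum_(i < N) f i.
Proof. by apply: eq_bigr => i _; rewrite mul1r. Qed.

Lemma cut_sumN N f : cut_sum N N f = - cut_sum N 0 f.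
Proof.
by rewrite cut_sum0 -sumrN; apply: eq_bigr => i _; rewrite ltn_ord mulN1r.
Qed.

Lemma cut_sum_opp N j f g : (forall i, f i = - g i) -> cut_sum N j f = - cut_sum N j g.
Proof.
by move=> fg; rewrite -sumrN; apply: eq_bigr => i _; rewrite fg mulrN.
Qed.

Lemma eq_cut_sum N j f g : (forall i, (i < N)%N -> f i = g i) ->
  cut_sum N j f = cut_sum N j g.
Proof. by move=> fg; apply: eq_bigr => i _; rewrite fg. Qed.

Lemma cut_sum_lo k j f : (j <= 2 ^ k)%N ->
  cut_sum (2 ^ k.+1) j f = cut_sum (2 ^ k) j (fun i => f (0 * 2 ^ k + i)%N) +
    cut_sum (2 ^ k) 0 (fun i => f (1 * 2 ^ k + i)%N).
Proof.
move=> jk; rewrite /cut_sum expnS mul2n -addnn big_split_ord/=; congr (_ + _).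
by apply: eq_bigr => i _; rewrite mul1n ltnNge (leq_trans jk)// leq_addr.
Qed.

Lemma cut_sum_hi k j f : cut_sum (2 ^ k.+1) (2 ^ k + j) f =
    cut_sum (2 ^ k) (2 ^ k) (fun i => f (0 * 2 ^ k + i)%N) +
    cut_sum (2 ^ k) j (fun i => f (1 * 2 ^ k + i)%N).
Proof.
rewrite /cut_sum expnS mul2n -addnn big_split_ord/=; congr (_ + _).
  by apply: eq_bigr => i _; rewrite ltn_ord ltn_addr.
by apply: eq_bigr => i _; rewrite mul1n ltn_add2l.
Qed.

Definition bit k r (x : vert (diamond k)) (i : nat) : int := (code k r x i)%:R.

Lemma bit_half k r n s (x : vert (diamond k)) (b : bool) i : (i < 2 ^ k)%N ->
  bit k.+1 r (sval (diamond_half k n s) x) (b * 2 ^ k + i) =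
  if b == r n (+) s then bit k r x i else s%:R.
Proof. by move=> ik; rewrite /bit code_half//; case: ifP. Qed.

Lemma pow2S k : (2 ^ k.+1 = 2 ^ k + 2 ^ k)%N.
Proof. by rewrite expnS mul2n addnn. Qed.

Lemma sum_bit_half k r n s (x : vert (diamond k)) :
  \sum_(i < 2 ^ k.+1) bit k.+1 r (sval (diamond_half k n s) x) i =
  \sum_(i < 2 ^ k) bit k r x i + (s * 2 ^ k)%N%:R.
Proof.
have cst : \sum_(i < 2 ^ k) (s%:R : int) = (s * 2 ^ k)%N%:R.
  by rewrite sumr_const card_ord -mulrnA.
rewrite -cut_sum0 (cut_sum_lo k 0) // !cut_sum0 -cst.
have half_sum (b : bool) :
    \sum_(i < 2 ^ k) bit k.+1 r (sval (diamond_half k n s) x) (b * 2 ^ k + i) =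
    if b == r n (+) s then \sum_(i < 2 ^ k) bit k r x i else \sum_(i < 2 ^ k) s%:R.
  by case: ifP => h; apply: eq_bigr => i _; rewrite bit_half// h.
rewrite (half_sum false) (half_sum true).
by case: (r n (+) s); rewrite //= addrC.
Qed.

Lemma walk_poles k b : walk (diamond k) (2 ^ k) (pole b k) (pole (~~ b) k).
Proof.
wlog -> : b / b = false.
  by move=> H; case: b; [apply: walk_sym|]; exact: H.
elim: k => [|k IH]; first by exists true.
rewrite pow2S -(half_pole k 0 false) -(half_pole k 0 true).
apply: walk_trans (walk_hom _ _ (diamond_half k 0 false) _ _ _ IH) _.
by rewrite half_middle; exact: walk_hom IH.
Qed.

Lemma walk_half k n s t l (x : vert (diamond k)) : walk _ l x (pole t k) ->
  walk _ (l + (s (+) t) * 2 ^ k) (sval (diamond_half k n s) x) (pole t k.+1).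
Proof.
move=> /(walk_hom _ _ (diamond_half k n s)) w.
have [st|st] := eqVneq s t.
  by rewrite -st in w *; rewrite addbb addn0 -(half_pole k n).
have {}st : s = ~~ t by move: st; case: (s); case: (t).
rewrite {}st in w *; rewrite addNb addbb mul1n -(half_pole k n).
apply: walk_trans w _.
have -> : sval (diamond_half k n (~~ t)) (pole t k) =
    sval (diamond_half k n t) (pole (~~ t) k).
  by case: (t); rewrite /= half_middle.
by apply: walk_hom; rewrite -{2}[t]negbK; exact: walk_poles.
Qed.

(** The number of indices in the code does not depend on the tosses: it is the height [h], and the
    vertex lies on a walk of length [2 ^ k] between the poles. *)
Lemma height_exists k (x : vert (diamond k)) : exists h, [/\ (h <= 2 ^ k)%N,
  walk _ h x (pole false k), walk _ (2 ^ k - h) x (pole true k) &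
  forall r, \sum_(i < 2 ^ k) bit k r x i = h%:R].
Proof.
elim: k x => [|k IH] x.
  exists (x : bool); split; [by case: x|by case: x => //=; exists false|
                    by case: x => //=; exists true|].
  by move=> r; rewrite big_ord_recr big_ord0 /= add0r.
have [n [s [x' ->]]] := half_cover _ x.
have [h [hk w0 w1 hr]] := IH x'.
exists (h + s * 2 ^ k)%N; split.
- by rewrite pow2S; case: (s); lia.
- by have := walk_half _ n s _ _ _ w0; rewrite addbF.
- have := walk_half _ n s _ _ _ w1; rewrite addbT.
  by congr walk; rewrite pow2S; case: (s); lia.
- by move=> r; rewrite sum_bit_half hr natrD.
Qed.

Definition bit_diff k r (x y : vert (diamond k)) (i : nat) : int :=
  bit k r x i - bit k r y i.

Lemma bit_diffC k r (x y : vert (diamond k)) i :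
  bit_diff k r x y i = - bit_diff k r y x i.
Proof. by rewrite /bit_diff opprB. Qed.

(* As [r n] and [r m] differ with probability 1/2, half of the walk length is
   attained with probability at least 1/2. *)
Definition separated k (x y : vert (diamond k)) :=
  exists l n m, [/\ walk _ l x y, n <> m & forall r, r n != r m ->
    exists2 j, (j <= 2 ^ k)%N &
      l%:R <= 2 * `|cut_sum (2 ^ k) j (bit_diff k r x y)|].

Lemma separated_sym k x y : separated k x y -> separated k y x.
Proof.
move=> [l [n [m [w nm H]]]]; exists l, n, m; split=> //; first exact: walk_sym.
move=> r /H[j jk ?]; exists j => //.
by rewrite (cut_sum_opp _ _ _ _ (bit_diffC k r y x)) normrN.
Qed.

(** In a common copy the codes differ only inside the block [r n (+) s], where they repeat the codes
    in [diamond k]; the cut is moved into that block. *)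
Lemma separated_half k n s (x y : vert (diamond k)) : separated k x y ->
  separated k.+1 (sval (diamond_half k n s) x) (sval (diamond_half k n s) y).
Proof.
move=> [l [p [q [w pq H]]]]; exists l, p, q; split=> //; first exact: walk_hom w.
move=> r /H[j jk lj].
have D (b : bool) j' : cut_sum (2 ^ k) j' (fun i => bit_diff k.+1 r
      (sval (diamond_half k n s) x) (sval (diamond_half k n s) y) (b * 2 ^ k + i)%N) =
    if b == r n (+) s then cut_sum (2 ^ k) j' (bit_diff k r x y) else 0.
  case: ifP => h.
    by apply: eq_cut_sum => i ik; rewrite /bit_diff !bit_half// h.
  rewrite /cut_sum big1// => i _; rewrite /bit_diff !bit_half// h subrr.
  by rewrite mulr0.
case h : (r n (+) s).
  exists (2 ^ k + j)%N; first by rewrite pow2S leq_add2l.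
  by rewrite cut_sum_hi (D false) (D true) h add0r.
exists j; first by rewrite pow2S (leq_trans jk)// leq_addr.
by rewrite cut_sum_lo// (D false) (D true) h addr0.
Qed.

(* The values at cuts 0 and [2 ^ k] are [A + B] and [B - A], where [A] and [B]
   are the sums over the two halves. *)
Lemma separated_halves k n m s t (x y : vert (diamond k)) : (n, s) != (m, t) ->
  separated k.+1 (sval (diamond_half k n s) x) (sval (diamond_half k m t) y).
Proof.
wlog : n m s t x y / (s <= t)%N.
  move=> H nsmt; have [st|/ltnW ts] := leqP s t; first exact: H.
  by apply/separated_sym/H => //; rewrite eq_sym.
move=> st nsmt.
have [hx [hxk x0 x1 xr]] := height_exists k x.
have [hy [hyk y0 y1 yr]] := height_exists k y.
set X := sval _ x; set Y := sval _ y.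
pose D r (b : bool) := cut_sum (2 ^ k) 0
  (fun i => bit_diff k.+1 r X Y (b * 2 ^ k + i)%N).
have DE r b : D r b = (if b == r n (+) s then hx%:R else (s * 2 ^ k)%N%:R) -
    (if b == r m (+) t then hy%:R else (t * 2 ^ k)%N%:R).
  rewrite /D cut_sum0 sumrB; congr (_ - _).
    rewrite (eq_bigr (fun i : 'I__ => if b == r n (+) s then bit k r x i else s%:R)).
      by case: ifP => _; rewrite ?xr// sumr_const card_ord -mulrnA.
    by move=> i _; rewrite bit_half.
  rewrite (eq_bigr (fun i : 'I__ => if b == r m (+) t then bit k r y i else t%:R)).
    by case: ifP => _; rewrite ?yr// sumr_const card_ord -mulrnA.
  by move=> i _; rewrite bit_half.
have cut0 r : cut_sum (2 ^ k.+1) 0 (bit_diff k.+1 r X Y) = D r false + D r true.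
  by rewrite cut_sum_lo.
have cut1 r : cut_sum (2 ^ k.+1) (2 ^ k) (bit_diff k.+1 r X Y) = D r true - D r false.
  by rewrite -[X in cut_sum _ X]addn0 cut_sum_hi cut_sumN addrC.
have k0 : (0 <= 2 ^ k.+1)%N by [].
have k1 : (2 ^ k <= 2 ^ k.+1)%N by rewrite pow2S leq_addr.
have conc l n' m' : walk _ l X Y -> n' <> m' -> (forall r, r n' != r m' ->
    (l%:R <= 2 * `|D r false + D r true|) || (l%:R <= 2 * `|D r true - D r false|)) ->
    separated k.+1 X Y.
  move=> w nm H; exists l, n', m'; split=> // r /H/orP[h|h].
    by exists 0%N => //; rewrite cut0.
  by exists (2 ^ k)%N => //; rewrite cut1.
have bottom : walk _ (hx + s * 2 ^ k + (hy + t * 2 ^ k)) X Y.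
  apply: walk_trans (walk_sym _ _ _ _ _).
    by have := walk_half _ n s _ _ _ x0; rewrite addbF; exact.
  by have := walk_half _ m t _ _ _ y0; rewrite addbF; exact.
have top : walk _ (2 ^ k - hx + ~~ s * 2 ^ k + (2 ^ k - hy + ~~ t * 2 ^ k)) X Y.
  apply: walk_trans (walk_sym _ _ _ _ _).
    by have := walk_half _ n s _ _ _ x1; rewrite addbT; exact.
  by have := walk_half _ m t _ _ _ y1; rewrite addbT; exact.
have [nm|nm] := eqVneq n m.
  subst m; have {nsmt} [sE tE] : s = false /\ t = true.
    by move: st nsmt; rewrite xpair_eqE eqxx; case: (s); case: (t).
  (* The walk goes up through the common middle vertex. The cut 0 recovers its whole length for
     every outcome, so 0 and 1 are just an arbitrary pair of distinct tosses. *)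
  subst s t; apply: (conc (2 ^ k - hx + hy)%N 0%N 1%N) => //.
    apply: walk_trans (walk_hom _ _ (diamond_half k n false) _ _ _ x1) _.
    by rewrite half_middle; apply: walk_sym; exact: walk_hom y0.
  move=> r _; rewrite !DE mul0n mul1n; move: hxk hyk; move: (2 ^ k)%N => N.
  by case: (r n) => /=; lia.
(* The walks through the bottom and the top pole have total length [4 * 2 ^ k]; the shorter one has
   length at most [2 * 2 ^ k]. *)
have {bottom top} [l w [lb lt lN]] : exists2 l, walk _ l X Y &
    [/\ (l <= hx + s * 2 ^ k + (hy + t * 2 ^ k))%N,
    (l <= 2 ^ k - hx + ~~ s * 2 ^ k + (2 ^ k - hy + ~~ t * 2 ^ k))%N &
    (l <= 2 * 2 ^ k)%N].
  have [h|h] := leqP (hx + s * 2 ^ k + (hy + t * 2 ^ k))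
    (2 ^ k - hx + ~~ s * 2 ^ k + (2 ^ k - hy + ~~ t * 2 ^ k)).
    exists (hx + s * 2 ^ k + (hy + t * 2 ^ k))%N => //; split=> //.
    move: h hxk hyk; move: (2 ^ k)%N => N; case: (s); case: (t) => /=; lia.
  eexists; first exact: top; split=> //; first exact: ltnW.
  move: h hxk hyk; move: (2 ^ k)%N => N; case: (s); case: (t) => /=; lia.
apply: (conc l n m) => // [|r]; first exact/eqP.
rewrite !DE {w conc D DE cut0 cut1 k0 k1 nsmt xr yr}.
move: (2 ^ k)%N lb lt lN hxk hyk => N; move: st.
by case: (s); case: (t) => //= _; case: (r n); case: (r m) => //=; lia.
Qed.

Lemma diamond_separated k (x y : vert (diamond k)) : separated k x y.
Proof.
elim: k x y => [|k IH] x y.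
  have [->|xy] := eqVneq (x : bool) y.
    by exists 0%N, 0%N, 1%N; split=> // r _; exists 0%N.
  exists 1%N, 0%N, 1%N; split=> //.
    by exists y => //; exact/eqP.
  move=> r _; exists 0%N => //; rewrite cut_sum0 big_ord_recr big_ord0 /= add0r.
  by move: xy; rewrite /bit_diff /bit /=; case: x; case: y.
have [n [s [x' ->]]] := half_cover _ x.
have [m [t [y' ->]]] := half_cover _ y.
have [[<- <-]|nsmt] := eqVneq (n, s) (m, t); first exact: separated_half.
exact: separated_halves.
Qed.

End Separation.

(** * Bochner distance *)

Section BochnerDist.
Context {d} {T : measurableType d} {R : realType} {Y : normedModType R}.
Variables (mu : {measure set T -> \bar R}) (p : R).
Hypothesis p1 : 1 <= p.

(** Measurability is known for level sets only, so the preimage is split into finitely many joint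
    level sets. *)
Lemma vsimple_dist_measurable (s s' : T -> Y) : vsimple s -> vsimple s' ->
  measurable_fun setT (fun t => `|s t - s' t|).
Proof.
move=> [fs ms] [fs' ms'] _ B mB; rewrite setTI.
pose D := [set q | (range s `*` range s') q /\ B `|q.1 - q.2|].
rewrite [X in measurable X](_ : _ =
    \bigcup_(q in D) (s @^-1` [set q.1] `&` s' @^-1` [set q.2])).
  apply: fin_bigcup_measurable => [|q _]; last exact: measurableI.
  by apply: sub_finite_set (finite_setX fs fs') => q [].
apply/seteqP; split=> [t /= Bt|t [q [_ Bq] [/= -> ->]]//].
by exists (s t, s' t) => //; split=> //; split; exists t.
Qed.

Lemma vsimple_cst (y : Y) : vsimple (fun _ : T => y).
Proof.
split=> [|z]; first by apply: sub_finite_set (finite_set1 y) => _ [t _ <-].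
have [yz|yz] := pselect (y = z).
  by rewrite (_ : _ @^-1` _ = setT)//; apply/seteqP; split.
by rewrite (_ : _ @^-1` _ = set0)//; apply/seteqP; split.
Qed.

Lemma strongly_measurable_dist (f g : T -> Y) :
  strongly_measurable f -> strongly_measurable g ->
  measurable_fun setT (fun t => `|f t - g t|).
Proof.
move=> [s ss sf] [s' ss' sg].
apply: (@measurable_fun_cvg _ _ _ _ (fun n t => `|s n t - s' n t|)).
  by move=> n; exact: vsimple_dist_measurable.
by move=> t _; apply: cvg_norm; apply: cvgB; [exact: sf|exact: sg].
Qed.

Lemma vsimple_strongly_measurable (s : T -> Y) : vsimple s -> strongly_measurable s.
Proof. by move=> ss; exists (fun=> s) => // t; exact: cvg_cst. Qed.

Let p0 : 0 < p. Proof. exact: lt_le_trans p1. Qed.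

Lemma measurable_powR_dist (g : T -> R) : measurable_fun setT g ->
  measurable_fun setT (fun t => `|(g t)%:E|%E `^ p)%E.
Proof.
move=> mg; apply: (@measurableT_comp _ _ _ _ _ _ (poweR ^~ p)).
  exact: measurable_poweR.
by apply: measurableT_comp => //; exact/measurable_EFinP.
Qed.

Lemma Lnorm_le_cst (g : T -> R) c : 0 <= c -> mu setT = 1%E ->
  measurable_fun setT g -> (forall t, 0 <= g t <= c) ->
  (Lnorm mu p%:E (EFin \o g) <= c%:E)%E.
Proof.
move=> c0 mu1 mg gc; rewrite unlock.
have h : (\int[mu]_x (`|(EFin \o g) x| `^ p) <= (c `^ p)%:E)%E.
  rewrite -[leRHS]mule1 -mu1 -integral_cst//; apply: ge0_le_integral => //.
  - by move=> x _; exact: poweR_ge0.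
  - exact: measurable_powR_dist.
  - move=> x _ /=; rewrite lee_fin; have /andP[gx gxc] := gc x.
    by rewrite ger0_norm// ge0_ler_powR// ?nnegrE// ltW.
have -> : c%:E = ((c `^ p)%:E `^ p^-1)%E.
  by rewrite poweR_EFin -powRrM mulfV ?gt_eqF// powRr1.
apply: gt0_ler_poweR => //; first by rewrite invr_ge0 ltW.
- by rewrite in_itv/= leey integral_ge0// => x _; exact: poweR_ge0.
- by rewrite in_itv/= leey lee_fin powR_ge0.
Qed.

(** Markov's inequality, in the form of a lower bound for the norm. *)
Lemma Lnorm_ge_cst (g : T -> R) c a (A : set T) : 0 <= c -> 0 <= a ->
  measurable A -> (a%:E <= mu A)%E -> measurable_fun setT g ->
  (forall t, A t -> c <= g t) ->
  ((c * a `^ p^-1)%:E <= Lnorm mu p%:E (EFin \o g))%E.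
Proof.
move=> c0 a0 mA aA mg gc; rewrite unlock.
have mg' := measurable_powR_dist _ mg.
have h : ((c `^ p * a)%:E <= \int[mu]_x (`|(EFin \o g) x| `^ p))%E.
  apply: le_trans (_ : \int[mu]_(x in A) (`|(EFin \o g) x| `^ p) <= _)%E; last first.
    by apply: ge0_subset_integral => // x _; exact: poweR_ge0.
  apply: le_trans (_ : (c `^ p)%:E * mu A <= _)%E.
    by rewrite EFinM lee_pmul// lee_fin// powR_ge0.
  rewrite -integral_cst//; apply: ge0_le_integral => //.
  - by move=> x _; rewrite lee_fin powR_ge0.
  - exact: measurable_funS mg'.
  - move=> x /gc cg /=; rewrite lee_fin.
    have g0 : 0 <= g x by exact: le_trans cg.
    by rewrite ger0_norm// ge0_ler_powR// ?nnegrE// ltW.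
have -> : (c * a `^ p^-1)%:E = ((c `^ p * a)%:E `^ p^-1)%E.
  rewrite poweR_EFin powRM ?powR_ge0//.
  by rewrite -powRrM mulfV ?gt_eqF// powRr1.
apply: gt0_ler_poweR => //; first by rewrite invr_ge0 ltW.
- by rewrite in_itv/= leey lee_fin mulr_ge0// powR_ge0.
- by rewrite in_itv/= leey integral_ge0// => x _; exact: poweR_ge0.
Qed.

(** The representative of a class agrees almost everywhere with the function that defines the class,
    so the integral is unchanged. *)
Lemma bochner_dist_pi (f g : bochner_fun Y mu p) :
  bochner_dist (\pi_(bochner_space Y mu p) f)%qT (\pi_(bochner_space Y mu p) g)%qT =
  fine (vLnorm mu p (fun t => f t - g t)).
Proof.
have E (u : bochner_fun Y mu p) :
    ae_eq mu setT (repr (\pi_(bochner_space Y mu p) u)%qT : bochner_fun Y mu p) u.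
  have /eqmodP/asboolP // : (\pi_(bochner_space Y mu p)
    (repr (\pi_(bochner_space Y mu p) u)) = \pi_(bochner_space Y mu p) u)%qT.
  by rewrite reprK.
rewrite /bochner_dist /vLnorm; congr fine; rewrite unlock; congr poweR.
have m (u v : bochner_fun Y mu p) :
    measurable_fun setT (fun t => `|(`|u t - v t|%R)%:E| `^ p)%E.
  apply: measurable_powR_dist; apply: strongly_measurable_dist.
    exact: bochner_meas u.
  exact: bochner_meas v.
apply: ae_eq_integral => //.
by near=> t => _; rewrite (near (E f) t)// (near (E g) t).
Unshelve. all: by end_near. Qed.

End BochnerDist.

(** * Coin tosses and the embedding *)

Section Coins.
Context {R : realType}.

(** For [0 <= t < 1] this is the binary digit of [t] of weight [2^-(n+1)]; under Lebesgue measure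
    these digits are independent fair tosses. *)
Definition coin (t : R) (n : nat) : bool := odd (Num.truncn (2 ^+ n.+1 * t)).

Definition dyadic (N i : nat) : set R := `[i%:R / 2 ^+ N, i.+1%:R / 2 ^+ N[.

Lemma dyadicP N i t : dyadic N i t <-> i%:R <= 2 ^+ N * t < i.+1%:R.
Proof.
rewrite /dyadic /= in_itv/= ler_pdivrMr ?exprn_gt0// ltr_pdivlMr ?exprn_gt0//.
by rewrite mulrC.
Qed.

Lemma dyadic_ge0 N i t : dyadic N i t -> 0 <= 2 ^+ N * t.
Proof. by move/dyadicP => /andP[+ _]; apply: le_trans; rewrite ler0n. Qed.

Lemma dyadic_truncn N i t : dyadic N i t -> Num.truncn (2 ^+ N * t) = i.
Proof.
by move=> ti; apply/eqP; rewrite truncn_eq ?(dyadic_ge0 _ _ _ ti)//; apply/dyadicP.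
Qed.

Lemma coin_dyadic N n i t : (n < N)%N -> dyadic N i t ->
  coin t n = odd (i %/ 2 ^ (N - n.+1)).
Proof.
move=> nN ti; congr odd; apply/eqP; have t0 := dyadic_ge0 _ _ _ ti.
have NE : 2 ^+ N = (2 ^ (N - n.+1))%N%:R * 2 ^+ n.+1 :> R.
  by rewrite natrX -exprD subnK.
set D := (2 ^ (N - n.+1))%N in NE *.
have D0 : (0 < D)%N by rewrite expn_gt0.
move/dyadicP : ti; rewrite NE -mulrA => /andP[h1 h2].
rewrite truncn_eq; last by rewrite NE -mulrA pmulr_rge0 ?ltr0n in t0.
apply/andP; split.
  rewrite -(ler_pM2l (_ : 0 < D%:R)) ?ltr0n// (le_trans _ h1)// -natrM ler_nat.
  by rewrite mulnC leq_trunc_div.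
rewrite -(ltr_pM2l (_ : 0 < D%:R)) ?ltr0n// (lt_le_trans h2)// -natrM ler_nat.
by rewrite mulnC -ltn_divLR.
Qed.

Lemma coin_measurable n : measurable [set t | coin t n].
Proof.
rewrite (_ : [set t | coin t n] = \bigcup_(i in [set i | odd i]) dyadic n.+1 i).
  by apply: bigcup_measurable => i _; exact: measurable_itv.
apply/seteqP; split=> [t /= tn|t [i /= oi /dyadic_truncn ti]]; last first.
  by rewrite /coin ti.
exists (Num.truncn (2 ^+ n.+1 * t)) => //; apply/dyadicP.
(* [Num.truncn] is 0 at negative reals, so an odd value forces a nonnegative argument. *)
apply: truncn_itv; rewrite leNgt; apply/negP => t0.
by move: tn; rewrite /coin truncn_floor leNgt t0.
Qed.

Lemma lebesgue01T : lebesgue01 R setT = 1%E.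
Proof.
rewrite /lebesgue01/= /mrestr setTI lebesgue_measure_itv/= lte_fin ltr01.
by rewrite oppr0 adde0.
Qed.

Lemma coin_neq_measurable n m : measurable [set t | coin t n != coin t m].
Proof.
rewrite (_ : [set _ | _] = ([set t | coin t n] `\` [set t | coin t m]) `|`
    ([set t | coin t m] `\` [set t | coin t n])).
  by apply: measurableU; apply: measurableD; exact: coin_measurable.
apply/seteqP; split=> t /=; case: (coin t n); case: (coin t m) => //.
- by left.
- by right.
- by case=> -[].
- by case=> -[].
Qed.

(* On [dyadic m.+1 (2 j)] and [dyadic m.+1 (2 j + 1)] the toss [n] takes the same
   value and the toss [m] takes different ones. *)
Lemma coin_neq_measure n m : n <> m ->
  ((2^-1)%:E <= lebesgue01 R [set t | coin t n != coin t m])%E.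
Proof.
wlog nm : n m / (n < m)%N.
  move=> H; case: (ltngtP n m) => // [nm|mn] nem; first exact: H.
  rewrite (_ : [set _ | _] = [set t | coin t m != coin t n]).
    exact: (H _ _ mn (nesym nem)).
  by apply/seteqP; split=> t /=; rewrite eq_sym.
move=> _; pose q j := odd (j %/ 2 ^ (m - n.+1)).
(* In each dyadic interval of level [m] this is the half on which toss [m] differs from toss [n];
   the [2 ^ m] halves in the unit interval have total length 1/2. *)
pose F j := dyadic m.+1 (j.*2 + ~~ q j).
have q_coin j (b : bool) t : dyadic m.+1 (j.*2 + b) t -> coin t n = q j /\ coin t m = b.
  move=> ti; split.
    have dE : (m.+1 - n.+1 = (m - n.+1).+1)%N by lia.
    rewrite (coin_dyadic _ _ _ _ (leqW nm) ti) /q dE.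
    rewrite expnS divnMA; congr (odd (_ %/ _)).
    by rewrite divn2 addnC half_bit_double.
  by rewrite (coin_dyadic _ _ _ _ (ltnSn m) ti) subnn divn1 oddD odd_double; case: (b).
have subF j t : (j < 2 ^ m)%N -> F j t ->
    ([set t | coin t n != coin t m] `&` `[0, 1]) t.
  move=> jm tF; split; first by have [/= -> ->] := q_coin _ _ _ tF; case: (q j).
  rewrite /= in_itv/=; move/dyadicP : tF (dyadic_ge0 _ _ _ tF) => /andP[_ h].
  rewrite pmulr_rge0 ?exprn_gt0// => -> /=.
  rewrite -(ler_pM2l (_ : 0 < 2 ^+ m.+1)) ?exprn_gt0// mulr1 (le_trans (ltW h))//.
  rewrite -natrX ler_nat expnS mul2n -addnn.
  by move: jm; rewrite -addnn; case: (q j) => /=; lia.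
have mF j : measurable (F j) by exact: measurable_itv.
have tF : trivIset setT F.
  move=> i j _ _ [t [/dyadic_truncn ti /dyadic_truncn tj]].
  have := congr1 half (etrans (esym ti) tj).
  by rewrite !(addnC _.*2) !half_bit_double.
have FE j : lebesgue_measure (F j) = ((2 ^+ m.+1)^-1)%:E.
  rewrite /F /dyadic lebesgue_measure_itv/= lte_fin ltr_pM2r ?invr_gt0 ?exprn_gt0//.
  rewrite ltr_nat ltnSn -EFinB -mulrBl -natrB// subSnn mul1r.
  by [].
have mA : measurable ([set t | coin t n != coin t m] `&` `[0, 1]).
  by apply: measurableI; [exact: coin_neq_measurable|exact: measurable_itv].
apply: le_trans (_ : lebesgue_measure (\big[setU/set0]_(i < 2 ^ m) F i) <= _)%E.
  rewrite measure_bigsetU//.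
  rewrite (eq_bigr (fun=> ((2 ^+ m.+1)^-1)%:E)); last by move=> i _; exact: FE.
  rewrite sumEFin lee_fin.
  rewrite sumr_const card_ord -[leRHS]mulr_natr natrX exprS invfM -mulrA mulVf ?mulr1//.
rewrite /lebesgue01/= /mrestr; apply: le_measure; rewrite ?inE//.
  by apply: bigsetU_measurable => i _; exact: mF.
by rewrite -bigcup_mkord => t [j /= jm]; exact: subF.
Qed.

End Coins.

(** * The random map into [Y] and its pointwise bounds *)

Section Embedding.
Context {R : realType} {Y : normedModType R}.

(** The sum depends on [t] only through a vector of [N] bits, and each bit pattern has a measurable
    set of occurrence. *)
Lemma vsimple_sum d (T : measurableType d) N (b : nat -> T -> bool) (y : nat -> Y) :
  (forall i, measurable [set t | b i t]) ->
  vsimple (fun t => \sum_(i < N) (b i t)%:R *: y i).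
Proof.
move=> mb; pose v (c : {ffun 'I_N -> bool}) := \sum_(i < N) (c i)%:R *: y i.
have vE t : \sum_(i < N) (b i t)%:R *: y i = v [ffun i : 'I_N => b i t].
  by apply: eq_bigr => i _; rewrite ffunE.
split.
  apply: sub_finite_set (finite_image v (@finite_finset _ [set: _])).
  by move=> _ [t _ <-]; rewrite vE; exists [ffun i : 'I_N => b i t].
move=> z; rewrite [X in measurable X](_ : _ =
  \bigcup_(c in v @^-1` [set z]) \bigcap_(i in [set: 'I_N]) [set t | b i t = c i]).
  apply: fin_bigcup_measurable => [|c _]; first exact: finite_finset.
  apply: fin_bigcap_measurable => [|i _]; first exact: finite_finset.
  case: (c i); first exact: mb.
  rewrite (_ : [set _ | _] = ~` [set t | b i t]); first exact: measurableC.
  by apply/seteqP; split=> t /= => [->//|/negP/negbTE].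
apply/seteqP; split=> [t /= <-|t [c /= <- ct]].
  by exists [ffun i : 'I_N => b i t]; [rewrite /= vE|move=> i _; rewrite /= ffunE].
by apply: eq_bigr => i _; rewrite ct.
Qed.

Lemma code_measurable k (x : vert (diamond k)) i :
  measurable [set t : R | code k (coin t) x i].
Proof.
elim: k x i => [|k IH] x i.
  case: x; first by rewrite [X in measurable X](_ : _ = setT)//; apply/seteqP; split.
  by rewrite [X in measurable X](_ : _ = set0)//; apply/seteqP; split.
case: x => [u|[e n]]; first exact: IH.
have [a [b [_ eE]]] := svalP e.
rewrite (_ : [set _ | _] =
    ([set t | code k (coin t) a i./2] `&` [set t | code k (coin t) b i./2]) `|`
    (([set t | code k (coin t) a i./2] `|` [set t | code k (coin t) b i./2]) `&`
     [set t | odd i = coin t n])); last first.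
  apply/seteqP; split=> t; rewrite /mkset (code_edge _ _ _ _ _ _ _ eE).
    by case/orP => [/andP[]|/andP[/orP ab /eqP]]; [left|right].
  by case=> [[/= -> ->]//|[/= ab oi]]; apply/orP; right; apply/andP; split;
    [exact/orP|exact/eqP].
apply: measurableU; apply: measurableI; rewrite ?IH//; first exact: measurableU.
case: (odd i).
  rewrite (_ : [set _ | _] = [set t | coin t n]); first exact: coin_measurable.
  by apply/seteqP; split.
rewrite (_ : [set _ | _] = ~` [set t | coin t n]).
  by apply: measurableC; exact: coin_measurable.
by apply/seteqP; split=> t /= => [<-//|/negP/negbTE].
Qed.

Lemma norm_sum_le N (c : nat -> R) (y : nat -> Y) : (forall i, `|y i| <= 1) ->
  `|\sum_(i < N) c i *: y i| <= \sum_(i < N) `|c i|.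
Proof.
move=> y1; apply: le_trans (ler_norm_sum _ _ _) _; apply: ler_sum => i _.
by rewrite normrZ -[leRHS]mulr1 ler_wpM2l.
Qed.

(* Moving the coefficients [c i] to the signs changes the sum by at most
   [sum_i (1 - sign_i * c i)]. *)
Lemma sign_sum_lower N j delta (c : nat -> R) (y : nat -> Y) :
  (forall i, `|y i| <= 1) -> (forall i, `|c i| <= 1) ->
  N%:R - delta <= `|\sum_(i < N) (-1) ^+ (i < j)%N *: y i| ->
  `|\sum_(i < N) (-1) ^+ (i < j)%N * c i| - delta <= `|\sum_(i < N) c i *: y i|.
Proof.
move=> y1; wlog S0 : c / 0 <= \sum_(i < N) (-1) ^+ (i < j)%N * c i.
  move=> H c1 yj; have [S0|/ltW S0] := leP 0 (\sum_(i < N) (-1) ^+ (i < j)%N * c i).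
    exact: H.
  have E : \sum_(i < N) (-1) ^+ (i < j)%N * - c i =
      - \sum_(i < N) (-1) ^+ (i < j)%N * c i.
    by rewrite -sumrN; apply: eq_bigr => i _; rewrite mulrN.
  have := H (fun i => - c i); rewrite E normrN oppr_ge0 S0.
  have -> : \sum_(i < N) - c i *: y i = - \sum_(i < N) c i *: y i.
    by rewrite -sumrN; apply: eq_bigr => i _; rewrite scaleNr.
  by rewrite normrN; apply=> // i; rewrite normrN.
move=> c1 yj; rewrite ger0_norm//.
have h := norm_sum_le N (fun i => (-1) ^+ (i < j)%N - c i) y y1.
have E1 : \sum_(i < N) ((-1) ^+ (i < j)%N - c i) *: y i =
    \sum_(i < N) (-1) ^+ (i < j)%N *: y i - \sum_(i < N) c i *: y i.
  by rewrite -sumrB; apply: eq_bigr => i _; rewrite scalerBl.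
have E2 : \sum_(i < N) `|(-1) ^+ (i < j)%N - c i| =
    N%:R - \sum_(i < N) (-1) ^+ (i < j)%N * c i.
  rewrite -[X in X%:R]card_ord -sumr_const -sumrB; apply: eq_bigr => i _.
  have := c1 i; rewrite ler_norml => /andP[? ?].
  case: (i < j)%N; rewrite ?expr1 ?expr0 ?mul1r ?mulN1r.
    by rewrite ler0_norm; lra.
  by rewrite ger0_norm; lra.
rewrite E1 E2 in h.
have := ler_distD 0 (\sum_(i < N) (-1) ^+ (i < j)%N *: y i) (\sum_(i < N) c i *: y i).
have := lerB_dist (\sum_(i < N) (-1) ^+ (i < j)%N *: y i) (\sum_(i < N) c i *: y i).
lra.
Qed.

Definition vertex_fun k (y : nat -> Y) (x : vert (diamond k)) (t : R) : Y :=
  \sum_(i < 2 ^ k) (code k (coin t) x i)%:R *: y i.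

Lemma vertex_fun_vsimple k y x :
  @vsimple _ (measurableTypeR R) R Y (vertex_fun k y x).
Proof.
apply: (@vsimple_sum _ (measurableTypeR R) _ (fun i t => code k (coin t) x i)) => i.
exact: code_measurable.
Qed.

Lemma vertex_funB k y x x' t : vertex_fun k y x t - vertex_fun k y x' t =
  \sum_(i < 2 ^ k) (bit_diff k (coin t) x x' i)%:~R *: y i.
Proof.
rewrite -sumrB; apply: eq_bigr => i _; rewrite -scalerBl.
by rewrite /bit_diff /bit rmorphB /= !mulrz_nat.
Qed.

Lemma bit_diff_le1 k r (x x' : vert (diamond k)) i :
  `|(bit_diff k r x x' i)%:~R| <= 1 :> R.
Proof.
rewrite /bit_diff /bit; do 2 case: (code _ _ _ _);
  by rewrite ?subrr ?subr0 ?sub0r ?mulrNz ?normrN ?normr0 ?normr1 ?ler01.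
Qed.

(** By [code_adj] an edge changes at most one coefficient, by at most 1, and the vectors have norm
    at most 1. *)
Lemma vertex_fun_path k y x s t : (forall i, `|y i| <= 1) ->
  path (fun u v => `[< adj u v >]) x s ->
  `|vertex_fun k y x t - vertex_fun k y (last x s) t| <= (size s)%:R.
Proof.
move=> y1; elim: s x => [|z s IH] x /=; first by rewrite subrr normr0.
move=> /andP[/asboolP xz /IH h].
apply: le_trans (ler_distD (vertex_fun k y z t) _ _) _.
rewrite -[leRHS]natr1 addrC; apply: lerD => //.
rewrite vertex_funB; have [i0 E] := code_adj _ (coin t) _ _ xz.
apply: le_trans (norm_sum_le _ (fun i => (bit_diff k (coin t) x z i)%:~R) _ y1) _.
apply: le_trans (_ : \sum_(i < 2 ^ k) (i == i0 :> nat)%:R <= _).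
  apply: ler_sum => i _; have [->|ii0] := eqVneq (i : nat) i0.
    exact: bit_diff_le1.
  by rewrite /bit_diff /bit E// subrr normr0.
have [i0k|i0k] := ltnP i0 (2 ^ k).
  rewrite (bigD1 (Ordinal i0k))//= eqxx big1 ?addr0// => i.
  by rewrite -val_eqE /= => /negbTE ->.
rewrite big1// => i _; rewrite (_ : _ == _ = false)//; apply/negbTE.
by rewrite neq_ltn (leq_trans (ltn_ord i)).
Qed.

Lemma vertex_fun_lower k (y : nat -> Y) (x x' : vert (diamond k)) (t : R) l j
    (delta : R) :
  (forall i, `|y i| <= 1) ->
  (2 ^ k)%N%:R - delta <= `|\sum_(i < 2 ^ k) (-1) ^+ (i < j)%N *: y i| ->
  (l%:R <= 2 * `|cut_sum (2 ^ k) j (bit_diff k (coin t) x x')|)%R ->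
  l%:R / 2 - delta <= `|vertex_fun k y x t - vertex_fun k y x' t|.
Proof.
move=> y1 yj lj; rewrite vertex_funB.
apply: le_trans (sign_sum_lower _ j delta
  (fun i => (bit_diff k (coin t) x x' i)%:~R) _ y1 _ yj); last first.
  by move=> i; exact: bit_diff_le1.
rewrite lerD2r ler_pdivrMr//.
have -> : \sum_(i < 2 ^ k) (-1) ^+ (i < j)%N * (bit_diff k (coin t) x x' i)%:~R =
    (cut_sum (2 ^ k) j (bit_diff k (coin t) x x'))%:~R :> R.
  rewrite /cut_sum rmorph_sum/=; apply: eq_bigr => i _.
  by rewrite rmorphM /= rmorphXn /= rmorphN1.
by rewrite -intr_norm mulrC -(ler_int R) rmorphM /= mulrz_nat in lj *.
Qed.

End Embedding.

(* Assembly of the embedding and its distortion *)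
Local Close Scope classical_set_scope.

Theorem corollary3p1 (R : realType) (p : R) (hp : 1 <= p)
    (Y : completeNormedModType R) (hY : ~ superreflexive Y)
    (eps : R) (heps : 0 < eps) (k : nat) :
  embeds_with_distortion
    (@path_dist R (diamond k))
    (@bochner_dist _ (measurableTypeR R) R Y (lebesgue01 R) p)
    (2 `^ (1 + p^-1) + eps).
Proof.
set q := 2 `^ p^-1.
have q0 : 0 < q by rewrite powR_gt0.
set D := _ + eps.
have DE : D = 2 * q + eps.
  by rewrite /D powRD ?powRr1//; apply/implyP => _; rewrite pnatr_eq0.
have D0 : 0 < D by rewrite DE; lra.
(* Chosen so that [(1 / 2 - delta) / q] is exactly [D^-1], the scaling constant below; [delta] is
   positive because [D] exceeds [2 * q]. *)
pose delta := 1 / 2 - q / D.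
have qD : q / D < 1 / 2 by rewrite ltr_pdivrMr// DE; lra.
have delta0 : 0 < delta by rewrite subr_gt0.
have [y [y1 yP]] := nonsuperreflexive_sign_separated _ hY (2 ^ k)%N delta delta0.
have mdist x x' := vsimple_dist_measurable _ _
  (vertex_fun_vsimple k y x) (vertex_fun_vsimple k y x').
have fin x : (vLnorm (lebesgue01 R) p (vertex_fun k y x) < +oo)%E.
  apply: le_lt_trans (ltry (2 ^ k)%N%:R).
  apply: (Lnorm_le_cst _ _ hp) => //; first exact: lebesgue01T.
    have := vsimple_dist_measurable _ _ (vertex_fun_vsimple k y x) (vsimple_cst 0).
    by under eq_fun do rewrite subr0.
  move=> t; rewrite normr_ge0/=.
  apply: le_trans (norm_sum_le _ (fun i => (code k (coin t) x i)%:R) _ y1) _.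
  rewrite -[X in X%:R]card_ord -sumr_const; apply: ler_sum => i _.
  by case: (code _ _ _ _); rewrite ?normr1 ?normr0.
pose f x := MkBochner
  (vsimple_strongly_measurable _ (vertex_fun_vsimple k y x)) (fin x).
exists (fun x => \pi_(bochner_space Y (lebesgue01 R) p)%qT (f x)).
exists D^-1 => [|x x']; first by rewrite invr_gt0.
rewrite bochner_dist_pi//= mulfV ?gt_eqF// mul1r.
set N := vLnorm _ _ _.
have N_path s : path (fun u v => `[< adj u v >]) x s -> last x s = x' ->
    (N <= (size s)%:R%:E)%E.
  move=> ps ls; rewrite /N -ls.
  apply: (Lnorm_le_cst (lebesgue01 R) p hp (fun t : measurableTypeR R =>
    `|vertex_fun k y x t - vertex_fun k y (last x s) t|)) => //.
  - exact: lebesgue01T.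
  - by move=> t; rewrite normr_ge0 vertex_fun_path.
have [l [n [m [/walk_path[s [ps ls ss]] nm sep]]]] := diamond_separated k x x'.
(* [fine] sends infinity to 0, so finiteness is established before real bounds are extracted. *)
have N_fin : N \is a fin_num.
  by rewrite ge0_fin_numE ?Lnorm_ge0// (le_lt_trans (N_path s ps ls))// ltry.
(* The walk length [l] dominates the distance, so it is enough to bound the norm from below by
   [l / D]. *)
have d_le : path_dist R x x' <= l%:R.
  apply: ge_inf; last by exists s; rewrite ?ss.
  by exists 0 => _ [s' _ <-].
apply/andP; split; last first.
  apply: lb_le_inf; first by exists l%:R, s; rewrite ?ss.
  by move=> _ [s' [ps' ls'] <-]; rewrite -lee_fin fineK// N_path.
apply: le_trans (_ : D^-1 * l%:R <= _); first by rewrite ler_wpM2l// invr_ge0 ltW.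
have [l0|l0] := posnP l; first by rewrite l0 mulr0 fine_ge0// Lnorm_ge0.
have l1 : 1 <= l%:R :> R by rewrite ler1n.
have ld0 : 0 <= l%:R / 2 - delta by rewrite /delta; have := divr_gt0 q0 D0; lra.
have half0 : 0 <= 2^-1 :> R by rewrite invr_ge0.
have := Lnorm_ge_cst (lebesgue01 R) p hp (fun t : measurableTypeR R =>
  `|vertex_fun k y x t - vertex_fun k y x' t|) _ _ _ ld0 half0
  (coin_neq_measurable n m) (coin_neq_measure n m nm) (mdist x x').
rewrite -[Lnorm _ _ _]/N -[N]fineK// lee_fin => N_ge.
apply: le_trans (N_ge _); last first.
  by move=> t /= /sep[j jk lj]; exact: vertex_fun_lower (yP j jk) lj.
have qV : (2^-1 `^ p^-1) * q = 1.
  by rewrite -powRM ?invr_ge0// mulVf// powR1.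
set u := _ `^ _ in qV *.
have u0 : 0 <= u by exact: powR_ge0.
apply: le_trans (_ : l%:R * (1 / 2 - delta) * u <= _).
  have -> : 1 / 2 - delta = q / D by rewrite /delta; ring.
  have -> : l%:R * (q / D) * u = D^-1 * l%:R * (u * q) by ring.
  by rewrite qV mulr1.
(* As [l >= 1], the absolute loss [delta] is absorbed into a loss proportional to [l]. *)
rewrite ler_wpM2r//; have : delta <= l%:R * delta by rewrite ler_peMl// ltW.
lra.
Qed.
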